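(* (i) Let $n \in \mathbb{N}$ and let $P_{2n}(z) = \sum_{k=0}^{2n} a_k z^k$ be a polynomial with $a_k \in \mathbb{C}\setminus\{0\}$ for all $k = 0, 1, \ldots, 2n$. Suppose that $|q_k(P_{2n})| > b_{2n}$ for all $k = 2, 3, \ldots, 2n$. Then all the zeros of $P_{2n}$ are simple. Moreover, the moduli of all zeros of $P_{2n}$ are pairwise different. (ii) Let $n \in \mathbb{N}$ and let $P_{2n+1}(z) = \sum_{k=0}^{2n+1} a_k z^k$ be a polynomial with $a_k \in \mathbb{C}\setminus\{0\}$ for all $k = 0, 1, \ldots, 2n+1$. Suppose that $|q_k(P_{2n+1})| \geq b_{2n+2}$ for all $k = 2, 3, \ldots, 2n+1$. Then all the zeros of $P_{2n+1}$ are simple. Moreover, the moduli of all zeros of $P_{2n+1}$ are pairwise different. (iii) Let $f(z)=\sum_{k=0}^\infty a_k z^k$ be an entire function with $a_k \in \mathbb{C}\setminus\{0\}$ for all $k \geq 0$. Suppose that $|q_k(f)| \geq b_{\infty}$ for all $k \geq 2$. Then all the zeros of $f$ are simple. Moreover, the moduli of all zeros of $f$ are pairwise different.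
   Context: $\mathbb{N} = \{1, 2, 3, \ldots\}$. For a polynomial or entire function $f(z)=\sum_{k=0}^{\omega} a_k z^k$, $\omega \in \{2,3,4,\ldots\}\cup\{\infty\}$, with all coefficients $a_k \in \mathbb{C}\setminus\{0\}$, the second quotients of its coefficients are $q_k(f) = \dfrac{a_{k-1}^2}{a_{k-2}a_k}$ for $2 \le k \le \omega$ (for all $k\ge 2$ if $\omega=\infty$). For $n \in \mathbb{N}$, $b_{2n}$ denotes the unique positive root $x$ of the equation $1 - 2\sum_{k=1}^{n} x^{-k^2/2} = 0$ (e.g. $b_2 = 4$). $b_\infty$ denotes the unique root $x>1$ of the equation $1 - 2\sum_{k=1}^{\infty} x^{-k^2/2} = 0$ (the series converges for $x > 1$); numerically $b_\infty \approx 4.81058280$. *)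

(* Defs.v *)
From HB Require Import structures.
From mathcomp Require Import all_boot all_order all_algebra.
From mathcomp Require Import all_classical all_reals all_analysis.
From mathcomp Require Import complex.
Set Implicit Arguments.
Unset Strict Implicit.
Unset Printing Implicit Defensive.
Import Order.TTheory GRing.Theory Num.Theory numFieldNormedType.Exports.
Local Open Scope classical_set_scope.
Local Open Scope ring_scope.

(* The field [R[i]] declared as a [numClosedFieldType]: the topology and the
   normed module structure of MathComp-Analysis are inferred on this form of
   the type, but not on [R[i]] itself. *)
Definition Cplx (R : realType) : numClosedFieldType := R[i]%C.

Definition second_quotient (C : fieldType) (a : nat -> C) (k : nat) : C :=
  a k.-1 ^+ 2 / (a k.-2 * a k).

Definition theta_sum (R : realType) (n : nat) (x : R) : R :=
  \sum_(1 <= k < n.+1) x `^ (- (k%:R ^+ 2 / 2)).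

(* [b_even R n] is $b_{2n}$, for n >= 1.  The default value 0 of [xget] is
   never reached then, as the equation has exactly one positive root. *)
Definition b_even (R : realType) (n : nat) : R :=
  xget 0 [set x : R | 0 < x /\ 1 - 2 * theta_sum n x = 0].

(* [limn] has an unspecified value on divergent sequences, but the series
   converges for every x > 1, and there is exactly one root there. *)
Definition b_infty (R : realType) : R :=
  xget 0 [set x : R | 1 < x /\ 1 - 2 * limn (fun n => theta_sum n x) = 0].

(* Over the field [Cplx R], [derivable f z 1] is complex differentiability. *)
Definition entire (R : realType) (f : Cplx R -> Cplx R) : Prop :=
  forall z : Cplx R, derivable f z 1.

Definition is_power_series (R : realType) (a : nat -> Cplx R)
    (f : Cplx R -> Cplx R) : Prop :=
  forall z : Cplx R, series (fun k => a k * z ^+ k) @ \oo --> f z.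

(* Polynomials are treated with [root] and the multiplicity [mup]; for entire
   functions a zero is simple when the derivative does not vanish. *)
Definition poly_zeros_simple (C : fieldType) (P : {poly C}) : Prop :=
  forall z : C, root P z -> mup z P = 1%N.

Definition zeros_simple (R : realType) (f : Cplx R -> Cplx R) : Prop :=
  forall z : Cplx R, f z = 0 -> derive1 f z != 0.

Definition zeros_moduli_distinct (R : realType) (f : Cplx R -> Cplx R) : Prop :=
  forall z w : Cplx R, f z = 0 -> f w = 0 -> z != w -> `|z| != `|w|.

(* Main.v *)
(* Write f = sum a_k z^k, t = b^(-1/2), and let rho_k be the radius where the
   terms of index k - 1 and k + 1 have the same modulus.  The bound on the second
   quotients gives |a_(k+j)| rho_k^(k+j) <= t^(j^2) |a_k| rho_k^k for all j, of
   either sign, so the term of index k strictly dominates the sum of all others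
   on |z| = rho_k; this is what the equation defining b is for.  It remains to
   see that between two radii rho < rho', dominated by the indices k and k + 1,
   there is at most one zero, and that it is simple.

   Rouche's theorem is replaced by a Wiener-Hopf argument.  Dominance makes the
   Toeplitz operator of the coefficients invertible: by a Neumann series there is
   c, summable at radius rho, such that g = f c is a monic polynomial of degree
   k, and any c bounded at radius rho for which f c is a polynomial of degree < k
   vanishes.  Let g' = f c' be the analogue of degree k + 1 for rho'.  Choosing w
   such that g' - (z - w) g has degree < k, uniqueness forces c' = (z - w) c,
   hence f c' = (z - w) g.  Uniqueness also shows that g has no zero z with
   |z| >= rho, since otherwise c / (x - z) would be bounded.  Therefore
   |z - w| |g(z)| <= ||c'|| |f(z)| for |z| < rho', and w is the only possible
   zero of f in the annulus, and a simple one. *)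

Require Import Defs.
From HB Require Import structures.
From mathcomp Require Import all_boot all_order all_algebra.
From mathcomp Require Import all_classical all_reals all_analysis.
From mathcomp Require Import complex.
From mathcomp Require Import ring lra zify.
Set Implicit Arguments.
Unset Strict Implicit.
Unset Printing Implicit Defensive.
Import Order.TTheory GRing.Theory Num.Theory numFieldNormedType.Exports.
Local Open Scope classical_set_scope.
Local Open Scope ring_scope.
Local Open Scope complex_scope.

(** * The modulus as a real number *)

(** Norms in [Cplx R] take values in [Cplx R] itself, whose order is partial; [nm] is the same
    modulus as an element of [R]. *)
Definition nm (R : realType) (z : Cplx R) : R := complex.Re `|z|.

Lemma nmE (R : realType) (z : Cplx R) : `|z| = (nm z)%:C.
Proof. by rewrite /nm (normc_def (z : R[i])). Qed.

Lemma nm_ge0 (R : realType) (z : Cplx R) : 0 <= nm z.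
Proof. by rewrite -lecR -nmE; exact: normr_ge0. Qed.

Lemma nm0 (R : realType) : nm (0 : Cplx R) = 0.
Proof. by rewrite /nm normr0. Qed.

Lemma nm1 (R : realType) : nm (1 : Cplx R) = 1.
Proof. by rewrite /nm normr1. Qed.

Lemma nmN (R : realType) (z : Cplx R) : nm (- z) = nm z.
Proof. by rewrite /nm normrN. Qed.

Lemma nmM (R : realType) (z w : Cplx R) : nm (z * w) = nm z * nm w.
Proof. by apply: complexI; rewrite rmorphM /= -!nmE normrM. Qed.

Lemma nmX (R : realType) (z : Cplx R) n : nm (z ^+ n) = nm z ^+ n.
Proof. by elim: n => [|n IHn]; rewrite ?nm1 // !exprS nmM IHn. Qed.

Lemma nm_eq0 (R : realType) (z : Cplx R) : (nm z == 0) = (z == 0).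
Proof. by rewrite -[RHS]normr_eq0 nmE; apply/eqP/eqP => [->|/complexI]. Qed.

Lemma nm_gt0 (R : realType) (z : Cplx R) : (0 < nm z) = (z != 0).
Proof. by rewrite lt_neqAle nm_ge0 andbT eq_sym nm_eq0. Qed.

Lemma nmV (R : realType) (z : Cplx R) : nm z^-1 = (nm z)^-1.
Proof. by apply: complexI; rewrite fmorphV /= -!nmE normfV. Qed.

Lemma nmD (R : realType) (z w : Cplx R) : nm (z + w) <= nm z + nm w.
Proof. by rewrite -lecR rmorphD /= -!nmE; exact: ler_normD. Qed.

Lemma nm_sum (R : realType) (I : Type) (r : seq I) (P : pred I)
    (F : I -> Cplx R) :
  nm (\sum_(i <- r | P i) F i) <= \sum_(i <- r | P i) nm (F i).
Proof.
elim/big_ind2: _ => [|x u y v xu yv|//]; first by rewrite nm0.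
by rewrite (le_trans (nmD _ _))// lerD.
Qed.

Lemma nm_real (R : realType) (x : R) : 0 <= x -> nm (x%:C : Cplx R) = x.
Proof. by move=> x0; rewrite /nm ger0_norm// (lecR 0 x). Qed.

(** * Geometric error bounds and convergence with an explicit rate *)

Lemma ler_add_geometric (R : realType) (x b th M : R) :
  0 <= th < 1 -> (forall n, x <= b + th ^+ n * M) -> x <= b.
Proof.
move=> /andP[th0 th1] xM.
have h : b + th ^+ n * M @[n --> \oo] --> b.
  rewrite -[X in _ --> X]addr0 -(mul0r M); apply: cvgD; first exact: cvg_cst.
  by apply: cvgMl; apply: cvg_expr; rewrite ger0_norm.
by apply: (ler_cvg_to (cvg_cst x) h); exact: nearW.
Qed.

Lemma ler_geometric_eq0 (R : realType) (x th M : R) :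
  0 <= x -> 0 <= th < 1 -> (forall n, x <= th ^+ n * M) -> x = 0.
Proof.
move=> x0 th01 xM; apply/eqP; rewrite eq_le x0 andbT.
by apply: (ler_add_geometric th01) => n; rewrite add0r.
Qed.

Lemma geometric_sum_le (R : realType) (th : R) m n :
  0 <= th < 1 -> \sum_(m <= t < n) th ^+ t <= th ^+ m / (1 - th).
Proof.
move=> /andP[th0 th1]; have d0 : 0 < 1 - th by rewrite subr_gt0.
rewrite ler_pdivlMr //.
have [mn|nm] := leqP m n; last first.
  by rewrite big_geq 1?ltnW// mul0r exprn_ge0.
rewrite mulr_suml (eq_bigr (fun t => - (th ^+ t.+1 - th ^+ t))); last first.
  by move=> t _; rewrite exprSr opprB mulrBr mulr1.

by rewrite sumrN telescope_sumr// opprB gerBl exprn_ge0.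
Qed.

Lemma real_series_limit (R : realType) (u : nat -> R) (th K : R) :
  0 <= th < 1 -> (forall t, `|u t| <= th ^+ t * K) ->
  exists l, forall T, `|l - \sum_(t < T) u t| <= th ^+ T * (K / (1 - th)).
Proof.
move=> th01 uK; have /andP[th0 th1] := th01.
have K0 : 0 <= K by have := uK 0; rewrite expr0 mul1r; apply: le_trans.
have cu : cvgn (series u).
  apply: normed_cvg; apply: (series_le_cvg _ _ uK) => //.
    by move=> n; rewrite mulr_ge0 ?exprn_ge0.
  have -> : (fun t => th ^+ t * K) = geometric K th.
    by apply/funext => n; rewrite /geometric /= mulrC.
  by apply: is_cvg_geometric_series; rewrite ger0_norm.
exists (limn (series u)) => T.
have h : `|series u n - \sum_(t < T) u t| @[n --> \oo] -->
         `|limn (series u) - \sum_(t < T) u t|.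
  by apply: cvg_norm; apply: cvgB; [exact: cu|exact: cvg_cst].
apply: (ler_cvg_to h (cvg_cst _)); near=> n.
have Tn : (T <= n)%N by near: n; exact: nbhs_infty_ge.
rewrite /series /= -(big_mkord xpredT) (big_cat_nat (leq0n T) Tn)/= addrAC subrr add0r.
rewrite (le_trans (ler_norm_sum _ _ _))//.
apply: (@le_trans _ _ (\sum_(T <= i < n) th ^+ i * K)).
  by apply: ler_sum => i _; exact: uK.
rewrite -mulr_suml mulrCA mulrC ler_wpM2l//.
exact: geometric_sum_le.
Unshelve. all: by end_near. Qed.

Lemma Re_le_nm (R : realType) (z : Cplx R) : `|complex.Re z| <= nm z.
Proof. by rewrite -lecR -nmE; exact: (normc_ge_Re (z : R[i])). Qed.

Lemma nm_i (R : realType) : nm ('i : Cplx R) = 1.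
Proof. by rewrite /nm normCi. Qed.

Lemma Im_le_nm (R : realType) (z : Cplx R) : `|complex.Im z| <= nm z.
Proof.
rewrite -[leRHS]mul1r -nm_i -nmM mulrC.
by rewrite (le_trans _ (Re_le_nm _))// -normrN -ReiNIm.
Qed.

Lemma nm_le_ReIm (R : realType) (z : Cplx R) :
  nm z <= `|complex.Re z| + `|complex.Im z|.
Proof.
rewrite {1}[z](complexE (z : R[i])) (le_trans (nmD _ _))// nmM nm_i mul1r.
by rewrite lerD // /nm normc_def /= expr0n addr0 sqrtr_sqr.
Qed.

Lemma Re_sum (R : realType) n (u : nat -> Cplx R) :
  complex.Re (\sum_(t < n) u t) = \sum_(t < n) complex.Re (u t).
Proof. by apply: (big_morph (@complex.Re R)) => // -[a b] [c d]. Qed.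

Lemma Im_sum (R : realType) n (u : nat -> Cplx R) :
  complex.Im (\sum_(t < n) u t) = \sum_(t < n) complex.Im (u t).
Proof. by apply: (big_morph (@complex.Im R)) => // -[a b] [c d]. Qed.

(** Real and imaginary parts are summed separately, which reduces convergence to the completeness of
    [R]. *)
Lemma complex_series_limit (R : realType) (u : nat -> Cplx R) (th K : R) :
  0 <= th < 1 -> (forall t, nm (u t) <= th ^+ t * K) ->
  exists l, exists L, forall T, nm (l - \sum_(t < T) u t) <= th ^+ T * L.
Proof.
move=> th01 uK.
have [x xK] : exists l, forall T,
    `|l - \sum_(t < T) complex.Re (u t)| <= th ^+ T * (K / (1 - th)).
  apply: (real_series_limit (u := fun t => complex.Re (u t))) => // t.
  exact: le_trans (Re_le_nm _) (uK t).
have [y yK] : exists l, forall T,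
    `|l - \sum_(t < T) complex.Im (u t)| <= th ^+ T * (K / (1 - th)).
  apply: (real_series_limit (u := fun t => complex.Im (u t))) => // t.
  exact: le_trans (Im_le_nm _) (uK t).
exists (x +i* y); exists (K / (1 - th) + K / (1 - th)) => T.
rewrite mulrDr (le_trans (nm_le_ReIm _))// lerD //.
  have -> : complex.Re ((x +i* y : Cplx R) - \sum_(t < T) u t) =
      x - \sum_(t < T) complex.Re (u t).
    by rewrite -Re_sum; case: (\sum_(t < T) u t).
  exact: xK.
have -> : complex.Im ((x +i* y : Cplx R) - \sum_(t < T) u t) =
    y - \sum_(t < T) complex.Im (u t).
  by rewrite -Im_sum; case: (\sum_(t < T) u t).
exact: yK.
Qed.

(** * Weighted coefficients, Cauchy products and dominance *)

Definition wt (R : realType) (rho : R) (a : nat -> Cplx R) (i : nat) : R :=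
  nm (a i) * rho ^+ i.

Definition conv (R : realType) (a c : nat -> Cplx R) (m : nat) : Cplx R :=
  \sum_(i < m.+1) a i * c (m - i)%N.

(* The partial sums stand for the possibly infinite sum, which thus converges. *)
Definition dominant (R : realType) (a : nat -> Cplx R) (k : nat) (rho : R) :=
  exists th : R, 0 <= th < 1 /\
    forall N, \sum_(i < N | i != k :> nat) wt rho a i <= th * wt rho a k.

Lemma wt_ge0 (R : realType) (rho : R) (a : nat -> Cplx R) i :
  0 <= rho -> 0 <= wt rho a i.
Proof. by move=> r0; rewrite mulr_ge0 ?nm_ge0 ?exprn_ge0. Qed.

(** The rows [j + k] of the convolution form a Toeplitz system in [c] with diagonal entry [a k]; the
    remaining sum is what dominance controls. *)
Lemma conv_diag (R : realType) (a c : nat -> Cplx R) k j :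
  conv a c (j + k) =
    a k * c j + \sum_(i < (j + k).+1 | i != k :> nat) a i * c (j + k - i)%N.
Proof.
have kj : (k < (j + k).+1)%N by rewrite ltnS leq_addl.
by rewrite /conv (bigD1 (Ordinal kj)) //= addnK.
Qed.

Lemma conv_offdiag_le (R : realType) (rho : R) (a c : nat -> Cplx R) k j :
  0 <= rho ->
  nm (\sum_(i < (j + k).+1 | i != k :> nat) a i * c (j + k - i)%N)
     * rho ^+ (j + k) <=
  \sum_(i < (j + k).+1 | i != k :> nat) wt rho a i * wt rho c (j + k - i)%N.
Proof.
move=> r0; apply: (le_trans (ler_wpM2r (exprn_ge0 _ r0) (nm_sum _ _ _))).
rewrite mulr_suml; apply: ler_sum => i _.
by rewrite nmM mulrACA -exprD subnKC // -ltnS.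
Qed.

(** In each row the diagonal term is minus the off-diagonal sum, so dominance improves a uniform
    bound on [wt rho c] by the factor [th]; this is iterated. *)
Lemma dominant_conv_eq0 (R : realType) (rho M : R) (a c : nat -> Cplx R) k :
  0 < rho -> a k != 0 -> dominant a k rho ->
  (forall j, wt rho c j <= M) -> (forall j, conv a c (j + k) = 0) ->
  forall j, c j = 0.
Proof.
move=> r0 ak0 [th [th01 dom]] cM ac0 j; have /andP[th0 th1] := th01.
have wk0 : 0 < wt rho a k by rewrite mulr_gt0 ?nm_gt0 ?exprn_gt0.
suff h n : forall j, wt rho c j <= th ^+ n * M.
  have /eqP : wt rho c j = 0.
    by apply: (ler_geometric_eq0 (wt_ge0 c j (ltW r0)) th01) => n; exact: h.
  by rewrite mulf_eq0 expf_eq0 (gt_eqF r0) andbF orbF nm_eq0 => /eqP.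
elim: n => [|n IHn] {}j; first by rewrite mul1r.
rewrite -(ler_pM2l wk0) {1}/wt mulrACA -nmM -exprD addnC.
have /eqP := ac0 j; rewrite conv_diag addr_eq0 => /eqP ->; rewrite nmN.
apply: (le_trans (conv_offdiag_le _ _ _ _ (ltW r0))).
apply: (@le_trans _ _ (\sum_(i < (j + k).+1 | i != k :> nat)
    wt rho a i * (th ^+ n * M))).
  by apply: ler_sum => i _; apply: ler_wpM2l; [exact/wt_ge0/ltW|exact: IHn].
have thM : 0 <= th ^+ n * M by exact: le_trans (wt_ge0 c 0 (ltW r0)) (IHn 0).
rewrite -mulr_suml (_ : _ * (th ^+ n.+1 * M) = th * wt rho a k * (th ^+ n * M)).
  exact: (ler_wpM2r thM (dom _)).
by rewrite exprS; move: (wt rho a k) (th ^+ n) => x y; rewrite -!mulrA mulrCA.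
Qed.

(** * Neumann series for the Toeplitz system *)

(** For fixed [i] the indices [j + k - i] are distinct; the guard excludes the truncated
    subtractions, which would count [d 0] repeatedly. *)
Lemma sum_shift_le (R : realType) (d : nat -> R) (D : R) k i :
  (forall l, 0 <= d l) -> (forall N, \sum_(l < N) d l <= D) ->
  forall J, \sum_(j < J | (i < (j + k).+1)%N) d (j + k - i)%N <= D.
Proof.
move=> d0 dD J; apply: (@le_trans _ _ (\sum_(l < J + k - i) d l)); last exact: dD.
elim: J => [|J IHJ]; first by rewrite big_ord0 sumr_ge0.
rewrite big_mkcond big_ord_recr -big_mkcond /= ltnS addSn.
have [iJ|iJ] := leqP i (J + k); last first.
  have e1 : (J + k - i = 0)%N by apply/eqP; rewrite subn_eq0 ltnW.
  have e2 : ((J + k).+1 - i = 0)%N by apply/eqP; rewrite subn_eq0.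
  by move: IHJ; rewrite addr0 e1 e2 !big_ord0.
by rewrite subSn // big_ord_recr /= lerD2r.
Qed.

Lemma offdiag_l1_le (R : realType) (rho th D : R) (a d : nat -> Cplx R) k J :
  0 <= rho ->
  (forall N, \sum_(i < N | i != k :> nat) wt rho a i <= th) ->
  (forall N, \sum_(l < N) wt rho d l <= D) ->
  \sum_(j < J) \sum_(i < (j + k).+1 | i != k :> nat)
     wt rho a i * wt rho d (j + k - i)%N <= th * D.
Proof.
move=> r0 ath dD.
have D0 : 0 <= D by have := dD 0; rewrite big_ord0.
(* All inner ranges are widened to the common length [J + k], so that the two sums can be
   exchanged. *)
rewrite (eq_bigr (fun j : 'I_J => \sum_(i < J + k |
    (i < (j + k).+1)%N && (i != k :> nat))
    wt rho a i * wt rho d (j + k - i)%N)); last first.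
  move=> j _; have jJ : ((j + k).+1 <= J + k)%N by rewrite -addSn leq_add2r.
  rewrite (big_ord_widen_cond _ (fun i => i != k)
    (fun i => wt rho a i * wt rho d (j + k - i)%N) jJ).
  by apply: eq_bigl => i; rewrite andbC.
rewrite (exchange_big_dep (fun i : 'I_(J + k) => i != k :> nat)) /=; last first.
  by move=> j i _ /andP[].
apply: (@le_trans _ _ (\sum_(i < J + k | i != k :> nat) wt rho a i * D)).
  apply: ler_sum => i ik; rewrite -mulr_sumr ler_wpM2l ?wt_ge0//.
  under eq_bigl do rewrite ik andbT.
  by apply: sum_shift_le => // l; exact: wt_ge0.
by rewrite -mulr_suml ler_wpM2r.
Qed.

(* The [t]-th term of the Neumann series solving [conv a c (j + k) = (j == 0)]
   for [c], whose diagonal coefficient is [a k]. *)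
Fixpoint neumann (R : realType) (a : nat -> Cplx R) (k t j : nat) : Cplx R :=
  if t is t'.+1 then
    - (a k)^-1 * \sum_(i < (j + k).+1 | i != k :> nat)
      a i * neumann a k t' (j + k - i)%N
  else (a k)^-1 *+ (j == 0).

(** The off-diagonal part divided by [a k] contracts the weighted l1 norm by the factor [th]. *)
Lemma neumann_l1 (R : realType) (rho th : R) (a : nat -> Cplx R) k :
  0 < rho -> a k != 0 -> 0 <= th ->
  (forall N, \sum_(i < N | i != k :> nat) wt rho a i <= th * wt rho a k) ->
  forall t J, \sum_(j < J) wt rho (neumann a k t) j <= th ^+ t * (nm (a k))^-1.
Proof.
move=> r0 ak0 th0 dom; have nak0 : 0 < nm (a k) by rewrite nm_gt0.
have wk0 : 0 < wt rho a k by rewrite mulr_gt0 ?exprn_gt0.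
elim=> [|t IHt] J.
  rewrite mul1r; case: J => [|J]; first by rewrite big_ord0 invr_ge0 ltW.
  rewrite big_ord_recl /= /wt nmV mulr1 gerDl.
  by rewrite big1// => j _; rewrite nm0 mul0r.
rewrite -(ler_pM2l wk0).
rewrite (_ : _ * (th ^+ t.+1 * _) =
    th * wt rho a k * (th ^+ t * (nm (a k))^-1)); last first.
  by rewrite exprS; move: (wt rho a k) (th ^+ t) => x y; rewrite -!mulrA mulrCA.
apply: le_trans (offdiag_l1_le J (ltW r0) dom IHt).
rewrite mulr_sumr; apply: ler_sum => j _.
rewrite {1}/wt mulrACA -nmM -exprD addnC /= mulNr mulrN nmN.
by rewrite mulVKf // conv_offdiag_le ?ltW.
Qed.

Lemma dominant_conv_delta (R : realType) (rho : R) (a : nat -> Cplx R) k :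
  0 < rho -> a k != 0 -> dominant a k rho ->
  exists c, (exists S, forall N, \sum_(i < N) wt rho c i <= S) /\
    forall j, conv a c (j + k) = (j == 0)%:R.
Proof.
move=> r0 ak0 [th [th01 dom]]; have /andP[th0 th1] := th01.
pose d := neumann a k; pose K := (nm (a k))^-1.
have l1 := neumann_l1 r0 ak0 th0 dom.
have /choice[c /choice[L cL]] : forall j, exists l, exists L, forall T,
    nm (l - \sum_(t < T) d t j) <= th ^+ T * L.
  move=> j; apply: (@complex_series_limit _ (d^~ j) th (K / rho ^+ j)) => // t.
  rewrite mulrA ler_pdivlMr ?exprn_gt0//; apply: le_trans (l1 t j.+1).
  rewrite big_ord_recr /= lerDr sumr_ge0// => i _.
  by rewrite wt_ge0 ?ltW.
exists c; split.
  exists (K / (1 - th)) => N.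
  (* The error constant depends on [N] but not on the truncation [T], so it disappears as [T]
     grows. *)
  apply: (@ler_add_geometric _ _ _ th (\sum_(i < N) L i * rho ^+ i)) => // T.
  apply: (@le_trans _ _ (\sum_(i < N) (\sum_(t < T) wt rho (d t) i +
      th ^+ T * L i * rho ^+ i))).
    apply: ler_sum => i _; rewrite -mulr_suml -mulrDl.
    apply: ler_wpM2r; first by rewrite exprn_ge0 ?ltW.
    rewrite -[c i](subrK (\sum_(t < T) d t i)) [X in nm X <= _]addrC.
    by rewrite (le_trans (nmD _ _))// lerD// nm_sum.
  rewrite big_split /= lerD //; last first.
    by rewrite mulr_sumr; apply: ler_sum => i _; rewrite mulrA.
  rewrite exchange_big /=.
  apply: (@le_trans _ _ (\sum_(t < T) th ^+ t * K)).
    by apply: ler_sum => t _; exact: l1.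
  rewrite -mulr_suml mulrC ler_wpM2l ?invr_ge0 ?nm_ge0//.
  have := geometric_sum_le 0 T th01.
  by rewrite big_mkord expr0 div1r.
move=> j; apply/eqP; rewrite -subr_eq0 -nm_eq0; apply/eqP.
apply: (@ler_geometric_eq0 _ _ th (nm (a k) * (th * L j) +
  \sum_(i < (j + k).+1 | i != k :> nat) nm (a i) * L (j + k - i)%N)) => //.
  exact: nm_ge0.
move=> T.
(* The diagonal part of term [t.+1] cancels the off-diagonal part of term [t], so [T.+1] diagonal
   against [T] off-diagonal terms solve the row exactly. *)
have row : a k * (\sum_(t < T.+1) d t j) +
  \sum_(i < (j + k).+1 | i != k :> nat)
     a i * (\sum_(t < T) d t (j + k - i)%N) = (j == 0)%:R.
  rewrite big_ord_recl /= mulrDr mulrnAr divff //.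
  rewrite (eq_bigr (fun i : 'I_T => - (a k)^-1 *
    \sum_(i0 < (j + k).+1 | i0 != k :> nat) a i0 * d i (j + k - i0)%N)) //.
  rewrite -mulr_sumr mulrA mulrN divff // mulN1r -addrA exchange_big /=.
  by rewrite (eq_bigr _ (fun i _ => mulr_sumr _ _ _ _)) addNr addr0.
rewrite conv_diag -row opprD addrACA -mulrBr -sumrB.
rewrite (le_trans (nmD _ _))// [leRHS]mulrDr lerD //.
  by rewrite nmM mulrCA ler_wpM2l ?nm_ge0// mulrA -exprSr.
rewrite (le_trans (nm_sum _ _ _))// mulr_sumr; apply: ler_sum => i _.
by rewrite -mulrBr nmM mulrCA ler_wpM2l ?nm_ge0.
Qed.

(** * Division by a linear factor *)

(** Multiplication of a power series by its variable. *)
Definition shift_seq (R : realType) (u : nat -> Cplx R) (j : nat) : Cplx R :=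
  if j is j'.+1 then u j' else 0.

Lemma conv_shift (R : realType) (a c : nat -> Cplx R) m :
  conv a (shift_seq c) m = shift_seq (conv a c) m.
Proof.
rewrite /conv big_ord_recr /= subnn mulr0 addr0.
case: m => [|m] /=; first by rewrite big_ord0.
by apply: eq_bigr => i _; rewrite subSn // -ltnS.
Qed.

Lemma convD (R : realType) (a c d : nat -> Cplx R) (b : Cplx R) m :
  conv a (fun j => c j + b * d j) m = conv a c m + b * conv a d m.
Proof.
rewrite /conv mulr_sumr -big_split /=; apply: eq_bigr => i _.
by rewrite mulrDr mulrCA.
Qed.

(* If [z] were a root, dividing [c] by [x - z] would keep it bounded at radius
   [rho], because [rho <= |z|], and would lower the degree of [conv a c]. *)
Lemma dominant_not_root (R : realType) (rho S : R) (a c : nat -> Cplx R) k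
    (z : Cplx R) :
  0 < rho <= nm z -> a k != 0 -> dominant a k rho ->
  (forall N, \sum_(i < N) wt rho c i <= S) ->
  (forall j, conv a c (j + k) = (j == 0)%:R) ->
  (\poly_(i < k.+1) conv a c i).[z] != 0.
Proof.
move=> /andP[r0 rz] ak0 dom cS cg; apply/eqP => Gz.
have z0 : z != 0 by rewrite -nm_gt0 (lt_le_trans r0).
have nz0 : 0 < nm z by rewrite nm_gt0.
(* The coefficients of the power series [c / (x - z)]. *)
pose q j := - (\sum_(i < j.+1) c i * z ^+ i) / z ^+ j.+1.
have zq j : z * q j = - (\sum_(i < j.+1) c i * z ^+ i) / z ^+ j.
  by rewrite /q exprS invfM mulrCA [z * _]mulrA mulfV // mul1r.
have qc j : c j = shift_seq q j + - z * q j.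
  rewrite mulNr zq mulNr opprK; case: j => [|j] /=.
    by rewrite big_ord_recl big_ord0 !expr0 !mulr1 addr0 add0r divr1.
  rewrite (big_ord_recr j.+1) /= mulrDl mulfK ?expf_neq0//.
  by rewrite /q mulNr addrA addNr add0r.
have gq m : conv a c m = shift_seq (conv a q) m + - z * conv a q m.
  rewrite -conv_shift -convD; apply: eq_bigr => i _; congr (_ * _).
  exact: qc.
(* Dividing [f c] by [x - z] turns coefficients into partial sums at [z]; from index [k] on these
   equal the value of the polynomial at its root [z], which is 0. *)
have eq m : conv a q m * z ^+ m.+1 = - \sum_(i < m.+1) conv a c i * z ^+ i.
  elim: m => [|m IHm]; rewrite big_ord_recr /= gq.
    by rewrite big_ord0 /= !add0r expr0 mulr1 mulNr opprK mulrC.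
  by rewrite /= opprD -IHm mulrDl opprD addrA subrr add0r mulNr mulNr opprK exprS
    mulrCA mulrA.
have gsum j : \sum_(i < (j + k).+1) conv a c i * z ^+ i = 0.
  elim: j => [|j IHj]; first by rewrite -[RHS]Gz horner_poly.
  by rewrite big_ord_recr /= (cg j.+1) mul0r addr0.
have q0 : forall j, q j = 0.
  (* From [rho <= |z|] follows [|z|^(i-j) rho^j <= rho^i] for [i <= j], whence the bound
     [S / nm z]. *)
  apply: (dominant_conv_eq0 (M := S / nm z) r0 ak0 dom) => j; last first.
    have /eqP := eq (j + k)%N; rewrite gsum oppr0.
    by rewrite mulf_eq0 expf_eq0 (negPf z0) andbF orbF => /eqP.
  rewrite ler_pdivlMr // /wt /q nmM nmN nmV nmX.
  rewrite (_ : _ * _ * _ * _ = nm (\sum_(i < j.+1) c i * z ^+ i) *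
    (rho ^+ j / nm z ^+ j)); last first.
    rewrite exprS invfM; field.
    by rewrite expf_neq0 ?lt0r_neq0.
  rewrite mulrA ler_pdivrMr ?exprn_gt0//.
  apply: (@le_trans _ _ ((\sum_(i < j.+1) wt rho c i) * nm z ^+ j)); last first.
    by rewrite ler_wpM2r ?exprn_ge0 ?nm_ge0.
  apply: (le_trans (ler_wpM2r (exprn_ge0 _ (ltW r0)) (nm_sum _ _ _))).
  rewrite !mulr_suml; apply: ler_sum => i _; rewrite nmM nmX /wt -!mulrA.
  rewrite ler_wpM2l ?nm_ge0//.
  case: i => i /=; rewrite ltnS => ij.
  rewrite -(subnKC ij) !exprD mulrCA ler_wpM2l ?exprn_ge0 ?(ltW r0)//.
  by rewrite ler_wpM2l ?exprn_ge0 ?nm_ge0// lerXn2r ?nnegrE ?(ltW r0) ?nm_ge0.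
have := cg 0; rewrite eqxx add0n /conv big1 => [/eqP|i _].
  by rewrite eq_sym oner_eq0.
by rewrite qc q0 mulr0 addr0; case: (k - i)%N => [|n] /=; rewrite ?q0 mulr0.
Qed.

(** * Evaluation of truncated products *)

Lemma conv_partial_sum (R : realType) (a c : nat -> Cplx R) (y : Cplx R) N :
  \sum_(m < N) conv a c m * y ^+ m =
  \sum_(j < N) c j * y ^+ j * \sum_(i < N - j) a i * y ^+ i.
Proof.
elim: N => [|N IHN]; first by rewrite !big_ord0.
rewrite big_ord_recr /= IHN.
have -> : \sum_(j < N.+1) c j * y ^+ j * \sum_(i < N.+1 - j) a i * y ^+ i =
    \sum_(j < N.+1) c j * y ^+ j * \sum_(i < N - j) a i * y ^+ i +
    \sum_(j < N.+1) c j * a (N - j)%N * y ^+ N.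
  rewrite -big_split /=; apply: eq_bigr => -[j /=]; rewrite ltnS => jN _.
  rewrite subSn // big_ord_recr /= mulrDr; congr (_ + _).
  by rewrite mulrACA -exprD subnKC.
rewrite [X in _ = X + _]big_ord_recr /= subnn big_ord0 mulr0 addr0.
congr (_ + _); rewrite mulr_suml (reindex_inj rev_ord_inj) /=.
apply: eq_bigr => i _; have iN : (i <= N)%N by rewrite -ltnS.
by rewrite subSS subKn // [a _ * _]mulrC.
Qed.

(** A form of convergence shared by polynomials and entire functions. *)
Definition series_limit (R : realType) (a : nat -> Cplx R) (y l : Cplx R) :=
  forall e : R, 0 < e ->
    exists M, forall N, (M <= N)%N -> nm (l - \sum_(i < N) a i * y ^+ i) <= e.

Lemma dominant_l1 (R : realType) (rho : R) (a : nat -> Cplx R) k :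
  0 <= rho -> dominant a k rho ->
  exists S, forall N, \sum_(i < N) wt rho a i <= S.
Proof.
move=> r0 [th [/andP[th0 _] dom]]; exists (wt rho a k + th * wt rho a k) => N.
have wk := wt_ge0 a k r0.
have [kN|Nk] := ltnP k N.
  by rewrite (bigD1 (Ordinal kN)) //= lerD2l; exact: dom.
rewrite (eq_bigl (fun i : 'I_N => i != k :> nat)) => [|i]; last first.
  by rewrite neq_ltn (leq_trans (ltn_ord i) Nk).
by rewrite (le_trans (dom N))// lerDr.
Qed.

(** Beyond index [n], passing from radius [rho] to [nm y] gains at least the factor
    [(nm y / rho) ^+ n]. *)
Lemma series_tail_le (R : realType) (rho S : R) (a : nat -> Cplx R)
    (y l : Cplx R) :
  0 < rho -> nm y <= rho -> (forall N, \sum_(i < N) wt rho a i <= S) ->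
  series_limit a y l ->
  forall n, nm (l - \sum_(i < n) a i * y ^+ i) <= (nm y / rho) ^+ n * S.
Proof.
move=> r0 yr aS al n; apply/ler_addgt0Pl => e e0.
have [M lM] := al e e0; have {lM} := lM (maxn M n) (leq_maxl _ _).
have : (n <= maxn M n)%N by exact: leq_maxr.
move: (maxn M n) => N nN lN.
rewrite -(subrKA (\sum_(i < N) a i * y ^+ i)) (le_trans (nmD _ _))// lerD //.
rewrite -(big_mkord xpredT (fun i => a i * y ^+ i)).
rewrite -(big_mkord xpredT (fun i => a i * y ^+ i)).
rewrite (big_cat_nat (leq0n n) nN) /= addrAC subrr add0r.
apply: (le_trans (nm_sum _ _ _)).
have k0 : 0 <= nm y / rho by rewrite divr_ge0 ?nm_ge0 ?ltW.
have k1 : nm y / rho <= 1 by rewrite ler_pdivrMr // mul1r.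
apply: (@le_trans _ _ (\sum_(n <= i < N) (nm y / rho) ^+ n * wt rho a i)).
  rewrite big_nat [leRHS]big_nat; apply: ler_sum => i /andP[ni _].
  rewrite nmM nmX /wt mulrCA ler_wpM2l ?nm_ge0//.
  rewrite -{1}(divfK (lt0r_neq0 r0) (nm y)) exprMn.
  by rewrite ler_wpM2r ?exprn_ge0 ?(ltW r0)// ler_wiXn2l.
rewrite -mulr_sumr ler_wpM2l ?exprn_ge0//.
apply: le_trans (aS N); rewrite -(big_mkord xpredT (wt rho a)).
rewrite (big_cat_nat (leq0n n) nN) /= lerDr sumr_ge0// => i _.
exact/wt_ge0/ltW.
Qed.

(** The tail factor with exponent [N - j] combines with [nm y ^+ j] into
    [(nm y / rho) ^+ N * rho ^+ j], so the error decays uniformly in [j]. *)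
Lemma conv_partial_sum_le (R : realType) (rho S Sc : R) (a c : nat -> Cplx R)
    (y l : Cplx R) N :
  0 < rho -> nm y <= rho -> (forall N, \sum_(i < N) wt rho a i <= S) ->
  (forall N, \sum_(i < N) wt rho c i <= Sc) -> series_limit a y l ->
  nm (\sum_(m < N) conv a c m * y ^+ m) <=
    Sc * nm l + (nm y / rho) ^+ N * (S * Sc).
Proof.
move=> r0 yr aS cSc al.
have S0 : 0 <= S by have := aS 0; rewrite big_ord0.
have tail := series_tail_le r0 yr aS al.
rewrite conv_partial_sum; apply: (le_trans (nm_sum _ _ _)).
apply: (@le_trans _ _ (\sum_(j < N) wt rho c j *
    (nm l + (nm y / rho) ^+ N * S))); last first.
  rewrite -mulr_suml [_ * (S * Sc)]mulrA [_ * Sc]mulrC -mulrDr.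
  by rewrite ler_wpM2r// addr_ge0 ?nm_ge0// mulr_ge0// exprn_ge0 ?divr_ge0
    ?nm_ge0 ?(ltW r0).
apply: ler_sum => -[j /= jN] _; rewrite !nmM nmX /wt -!mulrA.
rewrite ler_wpM2l ?nm_ge0//.
have yj0 : 0 <= nm y ^+ j by rewrite exprn_ge0 ?nm_ge0.
have h : nm (\sum_(i < N - j) a i * y ^+ i) <=
    nm l + (nm y / rho) ^+ (N - j) * S.
  rewrite -[X in nm X](subKr l) (le_trans (nmD _ _))// nmN lerD2l.
  exact: tail.
apply: (le_trans (ler_wpM2l yj0 h)).
rewrite !mulrDr; apply: lerD.
  by rewrite ler_wpM2r ?nm_ge0// lerXn2r ?nnegrE ?nm_ge0 ?(ltW r0).
rewrite !mulrA ler_wpM2r // -{2}(subnKC (ltnW jN)) exprD mulrA -exprMn.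
by rewrite [rho * _]mulrC divfK ?lt0r_neq0.
Qed.

(** * Zeros between two radii with consecutive dominant indices *)

Lemma dominant_factor (R : realType) (rho rho' : R) (a : nat -> Cplx R) k :
  0 < rho <= rho' -> a k != 0 -> a k.+1 != 0 ->
  dominant a k rho -> dominant a k.+1 rho' ->
  exists (b : Cplx R) (G : {poly Cplx R}) (S : R),
    (forall z, rho <= nm z -> G.[z] != 0) /\
    (forall y l, nm y < rho' -> series_limit a y l ->
      nm (y - b) * nm G.[y] <= S * nm l).
Proof.
move=> /andP[r0 rr'] ak0 ak1 dom dom'.
have r'0 : 0 < rho' by exact: lt_le_trans rr'.
have [c [[Sc cS] cg]] := dominant_conv_delta r0 ak0 dom.
have [c' [[Sc' cS'] cg']] := dominant_conv_delta r'0 ak1 dom'.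
have [S aS] := dominant_l1 (ltW r'0) dom'.
pose g := conv a c; pose g' := conv a c'.
(* As [g] and [g'] are monic of degrees [k] and [k.+1], this [b] cancels the coefficient of degree
   [k] in [g' - (x - b) g]. *)
pose b := shift_seq g k - g' k.
(* The coefficients of [c' - (x - b) c]. They are bounded at radius [rho] because [c'] is summable
   at [rho' >= rho], and the shift costs a factor [rho]. *)
pose e j := (c' j + b * c j) + - 1 * shift_seq c j.
have wc d (r D : R) j : 0 < r -> (forall N, \sum_(i < N) wt r d i <= D) ->
    wt r d j <= D.
  move=> r00 dD; apply: le_trans (dD j.+1); rewrite big_ord_recr /= lerDr.
  by apply: sumr_ge0 => i _; exact/wt_ge0/ltW.
have e0 : forall j, e j = 0.
  apply: (dominant_conv_eq0 (M := Sc' + nm b * Sc + rho * Sc) r0 ak0 dom) => j.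
    apply: (@le_trans _ _ ((nm (c' j) + nm b * nm (c j) +
        nm (shift_seq c j)) * rho ^+ j)).
      rewrite ler_wpM2r ?exprn_ge0 ?(ltW r0)//.
      rewrite (le_trans (nmD _ _))// mulN1r nmN lerD2r.
      by rewrite (le_trans (nmD _ _))// nmM.
    rewrite !mulrDl !lerD //.
    - apply: le_trans (wc _ _ _ j r'0 cS'); rewrite ler_wpM2l ?nm_ge0//.
      by rewrite lerXn2r ?nnegrE ?(ltW r0) ?(ltW r'0).
    - by rewrite -mulrA ler_wpM2l ?nm_ge0//; exact: wc.
    case: j => [|j] /=.
      rewrite nm0 mul0r mulr_ge0 ?(ltW r0)//.
      exact: le_trans (wt_ge0 c 0 (ltW r0)) (wc _ _ _ 0 r0 cS).
    by rewrite exprS mulrCA ler_wpM2l ?(ltW r0)//; exact: wc.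
  rewrite /e convD convD conv_shift -/g -/g'.
  case: j => [|j].
    by rewrite add0n [g k](cg 0) mulr1 /b mulN1r addrCA subrr addr0 subrr.
  rewrite [g _]cg mulr0 addr0 addSn /= [g _]cg mulN1r.
  by rewrite -addnS [g' _]cg' subrr.
have gg' m : g' m = shift_seq g m - b * g m.
  have : conv a e m = 0 by apply: big1 => i _; rewrite e0 mulr0.
  rewrite /e convD convD conv_shift -/g -/g' mulN1r => /eqP.
  by rewrite subr_eq0 eq_sym -subr_eq => /eqP <-.
exists b; exists (\poly_(i < k.+1) g i); exists Sc'; split.
  by move=> z rz; apply: (dominant_not_root _ ak0 dom cS cg); rewrite r0.
move=> y l yr al.
have gk j : g (j.+1 + k)%N = 0 by rewrite [g _]cg.
have sumg n : \sum_(m < n + k.+1) g m * y ^+ m = (\poly_(i < k.+1) g i).[y].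
  elim: n => [|n IHn]; first by rewrite horner_poly.
  by rewrite addSn big_ord_recr /= IHn -addSnnS gk mul0r addr0.
(* The range is one longer than for [g] because [g'] has degree [k.+1]. *)
have sumg' n : \sum_(m < n.+1 + k.+1) g' m * y ^+ m =
    (y - b) * (\poly_(i < k.+1) g i).[y].
  rewrite mulrBl -{1}(sumg n) -(sumg n.+1) !mulr_sumr.
  under eq_bigr do rewrite gg' mulrBl -mulrA.
  rewrite sumrB; congr (_ - _).
  rewrite addSn big_ord_recl /= mul0r add0r.
  by apply: eq_bigr => i _; rewrite /= exprS mulrCA.
have k01 : 0 <= nm y / rho' < 1.
  by rewrite divr_ge0 ?nm_ge0 ?(ltW r'0)//= ltr_pdivrMr // mul1r.
rewrite -nmM; apply: (ler_add_geometric
  (M := (nm y / rho') ^+ k.+2 * (S * Sc')) k01) => n.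
have := conv_partial_sum_le (n.+1 + k.+1) r'0 (ltW yr) aS cS' al.
by rewrite -/g' (sumg' n) {1}addSnnS exprD -mulrA.
Qed.

Lemma horner_bounded (R : realType) (p : {poly Cplx R}) (z : Cplx R) :
  exists2 B : R, 0 <= B & forall h, nm h <= 1 -> nm p.[z + h] <= B.
Proof.
exists (\sum_(i < size p) nm p`_i * (nm z + 1) ^+ i) => [|h h1].
  by apply: sumr_ge0 => i _; rewrite mulr_ge0 ?exprn_ge0 ?addr_ge0 ?nm_ge0.
rewrite horner_coef (le_trans (nm_sum _ _ _))//; apply: ler_sum => i _.
rewrite nmM nmX ler_wpM2l ?nm_ge0// lerXn2r ?nnegrE ?addr_ge0 ?nm_ge0//.
by rewrite (le_trans (nmD _ _))// lerD2l.
Qed.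

(* Vanishing to order greater than one (when [f z = 0]), expressed without derivatives so as to
   cover polynomials and power series alike *)
Definition flat_at (R : realType) (f : Cplx R -> Cplx R) (z : Cplx R) :=
  forall e : R, 0 < e -> exists2 d : R, 0 < d &
    forall h, 0 < nm h < d -> nm (f (z + h)) <= e * nm h.

(** Any zero equals [b]. At [b + h] the factor inequality reads [|h| |G(b + h)| <= S |f(b + h)|];
    flatness would make the right side [o(|h|)], although [G(b) != 0]. *)
Lemma annulus_zeros (R : realType) (rho rho' : R) (a : nat -> Cplx R)
    (f : Cplx R -> Cplx R) k :
  0 < rho <= rho' -> a k != 0 -> a k.+1 != 0 ->
  dominant a k rho -> dominant a k.+1 rho' ->
  (forall y, series_limit a y (f y)) ->
  (forall z w, rho <= nm z < rho' -> rho <= nm w < rho' ->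
     f z = 0 -> f w = 0 -> z = w) /\
  (forall z, rho <= nm z < rho' -> f z = 0 -> ~ flat_at f z).
Proof.
move=> rr ak ak1 dom dom' af.
have [b [G [S [G0 Gf]]]] := dominant_factor rr ak ak1 dom dom'.
have zb z : rho <= nm z < rho' -> f z = 0 -> z = b.
  move=> /andP[rz zr] fz; have := Gf z (f z) zr (af z).
  rewrite fz nm0 mulr0 -nmM => le0.
  have : nm ((z - b) * G.[z]) == 0 by rewrite eq_le le0 nm_ge0.
  by rewrite nm_eq0 mulf_eq0 (negPf (G0 z rz)) orbF subr_eq0 => /eqP.
split=> [z w rz rw fz fw|z rz fz flat]; first by rewrite (zb z) // (zb w).
have ? := zb z rz fz; subst b; have /andP[rz1 rz2] := rz.
have g0 : 0 < nm G.[z] by rewrite nm_gt0 G0.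
have [Q GQ] : exists Q, G - (G.[z])%:P = Q * ('X - z%:P).
  by apply/factor_theorem; rewrite rootE !hornerE subrr.
have [B B0 QB] := horner_bounded Q z.
(* With this [e] flatness gives [|G(z + h)| <= |G(z)| / 4], while the last bound in [m] gives
   [|G(z + h) - G(z)| <= |G(z)| / 2]; together they contradict [G(z) != 0]. *)
pose e := nm G.[z] / (4 * (`|S| + 1)).
have S1 : 0 < `|S| + 1 by rewrite ltr_wpDl.
have e0 : 0 < e by rewrite divr_gt0 ?mulr_gt0.
have [d d0 fd] := flat e e0.
pose m := Num.min (Num.min d 1) (Num.min (rho' - nm z)
  (nm G.[z] / (2 * (B + 1)))).
have B1 : 0 < B + 1 by rewrite ltr_wpDl.
have m0 : 0 < m by rewrite !lt_min d0 ltr01 subr_gt0 rz2 divr_gt0 ?mulr_gt0.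
pose h : Cplx R := (m / 2)%:C.
have hE : nm h = m / 2 by rewrite nm_real // divr_ge0 ?ltW.
have h0 : 0 < nm h by rewrite hE divr_gt0.
have hm : nm h < m by rewrite hE ltr_pdivrMr // ltr_pMr // ltr1n.
have := hm; rewrite !lt_min => /andP[/andP[hd h1] /andP[hr hB]].
have zh : nm (z + h) < rho' by rewrite (le_lt_trans (nmD _ _))// -ltrBrDl.
have := Gf (z + h) _ zh (af _); rewrite addrAC subrr add0r => le1.
have le2 : nm (f (z + h)) <= e * nm h by apply: fd; rewrite h0.
have le3 : nm G.[z] <= nm G.[z + h] + nm h * B.
  have -> : G.[z] = G.[z + h] - Q.[z + h] * h.
    have := congr1 (horner^~ (z + h)) GQ.
    by rewrite !hornerE /= [z + h - z]addrAC subrr add0r => <-; rewrite subKr.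
  rewrite (le_trans (nmD _ _))// nmN nmM lerD2l mulrC ler_wpM2l ?nm_ge0//.
  by apply: QB; exact: ltW.
have le4 : nm h * B <= nm G.[z] / 2.
  apply: (@le_trans _ _ (nm G.[z] / (2 * (B + 1)) * B)).
    by rewrite ler_wpM2r // ltW.
  rewrite invfM mulrA -mulrA ler_piMr ?divr_ge0 ?nm_ge0//.
  by rewrite mulrC ler_pdivrMr // mul1r lerDl.
have le5 : nm G.[z + h] <= nm G.[z] / 4.
  rewrite -(ler_pM2l h0) (le_trans le1)//.
  apply: (@le_trans _ _ ((`|S| + 1) * (e * nm h))).
    apply: (@le_trans _ _ ((`|S| + 1) * nm (f (z + h)))).
      by rewrite ler_wpM2r ?nm_ge0// (le_trans (ler_norm S))// lerDl.
    by rewrite ler_wpM2l // ltW.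
  rewrite le_eqVlt; apply/orP; left; apply/eqP; rewrite /e.
  by field; rewrite lt0r_neq0.
lra.
Qed.

(** * From separating radii to simple zeros and distinct moduli *)

Definition separating (R : realType) (a : nat -> Cplx R) :=
  forall r : R, 0 < r -> exists k rho rho',
    [/\ 0 < rho <= r, r < rho', a k != 0 /\ a k.+1 != 0,
        dominant a k rho & dominant a k.+1 rho'].

(** Zeros of equal modulus lie in a common annulus. The origin, which no annulus covers, is not a
    zero because [a 0 != 0]. *)
Lemma separating_zeros (R : realType) (a : nat -> Cplx R)
    (f : Cplx R -> Cplx R) :
  a 0 != 0 -> (forall y, series_limit a y (f y)) -> separating a ->
  (forall z, f z = 0 -> ~ flat_at f z) /\ zeros_moduli_distinct f.
Proof.
move=> a0 af sep.
have f0 z : f z = 0 -> 0 < nm z.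
  move=> fz; rewrite nm_gt0; apply: contra_neq a0 => z0; apply/eqP.
  rewrite -nm_eq0 eq_le nm_ge0 andbT; apply/ler_addgt0Pl => e e0; rewrite addr0.
  have [M lM] := af z e e0; have := lM M.+1 (leqnSn M).
  rewrite fz sub0r nmN big_ord_recl expr0 mulr1 big1 ?addr0// => i _.
  by rewrite z0 expr0n mulr0.
have ann z : f z = 0 -> exists k rho rho',
    [/\ 0 < rho <= rho', rho <= nm z < rho', a k != 0 /\ a k.+1 != 0,
        dominant a k rho & dominant a k.+1 rho'].
  move=> fz; have [k [r [r' [/andP[r0 rz] zr ak d d']]]] := sep _ (f0 z fz).
  exists k, r, r'; split=> //; last by rewrite rz.
  by rewrite r0 (le_trans rz)// ltW.
split=> [z fz|z w fz fw]; last apply: contra_neq => nzw.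
  have [k [r [r' [rr rz [ak ak1] d d']]]] := ann z fz.
  have [_] := annulus_zeros rr ak ak1 d d' af.
  exact.
have nmzw : nm z = nm w by apply: complexI; rewrite -!nmE.
have [k [r [r' [rr rz [ak ak1] d d']]]] := ann z fz.
have [+ _] := annulus_zeros rr ak ak1 d d' af; apply => //.
by rewrite -nmzw.
Qed.

Lemma power_series_limit (R : realType) (a : nat -> Cplx R)
    (f : Cplx R -> Cplx R) :
  is_power_series a f -> forall y, series_limit a y (f y).
Proof.
move=> af y e e0; have := af y => /cvgrPdist_lt /(_ e%:C).
rewrite (ltcR 0 e) => /(_ e0) [M _ hM]; exists M => N MN.
have := hM N MN; rewrite /series /= big_mkord nmE (ltcR _ e) => /ltW.
by [].
Qed.

Lemma poly_series_limit (R : realType) (p : {poly Cplx R}) y :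
  series_limit (fun i => p`_i) y p.[y].
Proof.
move=> e e0; exists (size p) => N pN.
by rewrite (horner_coef_wide _ pN) subrr nm0 ltW.
Qed.

Lemma derive1_flat (R : realType) (f : Cplx R -> Cplx R) z :
  derivable f z 1 -> f z = 0 -> derive1 f z = 0 -> flat_at f z.
Proof.
move=> df fz f'z e e0.
have : h^-1 *: ((f \o shift z) (h *: (1 : Cplx R)) - f z) @[h --> 0^'] -->
    'D_1 f z by exact: df.
rewrite -derive1E f'z.
move=> /cvgrPdist_lt /(_ e%:C); rewrite (ltcR 0 e) => /(_ e0).
rewrite /dnbhs /within /= => /nbhs_ballP[d /= d0 hd].
(* The radius of a ball in [Cplx R] is a positive complex number, hence real. *)
have [d' d'E] : exists d' : R, d = d'%:C.
  by exists (complex.Re d); rewrite RRe_real // ger0_real ?ltW.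
move: d0 hd; rewrite d'E (ltcR 0) => d'0 hd; exists d' => // h /andP[h0 hd'].
have hn0 : h != 0 by rewrite -nm_gt0.
have := hd h; rewrite /= /ball_ /= sub0r normrN nmE (ltcR _ d') => /(_ hd' hn0).
rewrite fz subr0 sub0r normrN /= /GRing.scale /= mulr1 addrC nmE (ltcR _ e).
by rewrite nmM nmV mulrC ltr_pdivrMr // => /ltW.
Qed.

Lemma double_root_flat (R : realType) (p : {poly Cplx R}) z :
  ('X - z%:P) ^+ 2 %| p -> flat_at (horner p) z.
Proof.
move=> /dvdpP[q ->] e e0; have [B B0 qB] := horner_bounded q z.
have B1 : 0 < B + 1 by rewrite ltr_wpDl.
exists (Num.min 1 (e / (B + 1))) => [|h].
  by rewrite lt_min ltr01 divr_gt0.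
rewrite lt_min => /andP[h0 /andP[h1 hB]].
rewrite hornerM horner_exp hornerXsubC addrAC subrr add0r nmM nmX expr2 mulrA.
rewrite ler_pM2r // -ler_pdivlMr //; apply: le_trans (qB h (ltW h1)) _.
rewrite ler_pdivlMr //; apply: (@le_trans _ _ ((B + 1) * nm h)).
  by rewrite ler_wpM2r ?nm_ge0// lerDl.
by rewrite mulrC -ler_pdivlMr // ltW.
Qed.

Lemma separating_poly (R : realType) (p : {poly Cplx R}) :
  p`_0 != 0 -> separating (fun i => p`_i) ->
  poly_zeros_simple p /\ zeros_moduli_distinct (horner p).
Proof.
move=> p0 sep; have pn0 : p != 0 by apply: contraNneq p0 => ->; rewrite coef0.
have [flat dist] := separating_zeros p0 (poly_series_limit p) sep.
split=> // z rz; apply/eqP; rewrite eqn_leq mup_geq // dvdp_XsubCl rz andbT.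
rewrite leqNgt mup_geq //; apply/negP => /double_root_flat.
by apply: flat; apply/eqP.
Qed.

Lemma separating_entire (R : realType) (a : nat -> Cplx R)
    (f : Cplx R -> Cplx R) :
  entire f -> is_power_series a f -> a 0 != 0 -> separating a ->
  zeros_simple f /\ zeros_moduli_distinct f.
Proof.
move=> ef af a0 sep.
have [flat dist] := separating_zeros a0 (power_series_limit af) sep.
split=> // z fz; apply/eqP => f'z; apply: (flat z fz).
exact: derive1_flat.
Qed.

(** * Gaussian bounds from log-concavity *)

Section LogConcave.
Variables (R : realType) (A : nat -> R) (t : R) (k : nat).
Hypotheses (A_ge0 : forall m, 0 <= A m) (t0 : 0 < t)
  (A_supp : forall m, A m = 0 -> A m.+1 = 0)
  (A_concave : forall m, A m * A m.+2 <= t ^+ 2 * A m.+1 ^+ 2)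
  (Ak2 : A k.+2 != 0).

(** Here the terms of index [k] and [k.+2] agree in size; the central index is [k.+1]. *)
Definition central_radius := Num.sqrt (A k / A k.+2).
Local Notation rho := central_radius.

Let A_gt0 m : (m <= k.+2)%N -> 0 < A m.
Proof.
move=> mk; rewrite lt_neqAle A_ge0 andbT eq_sym; apply: contra_neq Ak2 => Am.
by rewrite -(subnK mk); elim: (_ - _)%N => // n; rewrite addSn; exact: A_supp.
Qed.

Lemma central_radius_gt0 : 0 < rho.
Proof. by rewrite sqrtr_gt0; apply: divr_gt0; apply: A_gt0; lia. Qed.

Let AkE : A k = rho ^+ 2 * A k.+2.
Proof. by rewrite sqr_sqrtr ?divfK // divr_ge0. Qed.

(** At radius [rho] the ratio of consecutive terms is at most [t] next to the centre and gains a
    factor [t ^+ 2] per further step. The odd exponents add up to the square in [up_le]. *)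
Let step_up j : A (k.+2 + j) * rho <= t ^+ j.*2.+1 * A (k.+1 + j).
Proof.
elim: j => [|j IHj].
  rewrite !addn0 expr1 -ler_sqr ?nnegrE ?mulr_ge0 ?(ltW central_radius_gt0) ?(ltW t0)//.
  rewrite !exprMn; apply: le_trans (A_concave k).
  by rewrite AkE [_ ^+ 2 * rho ^+ 2]mulrC expr2 mulrA.
have [Aj|Aj] := eqVneq (A (k.+1 + j)%N) 0.
  have Aj1 := A_supp Aj; have Aj2 := A_supp Aj1.
  have -> : (k.+2 + j.+1 = (k.+1 + j).+2)%N by rewrite !addSn addnS.
  by rewrite Aj2 mul0r mulr_ge0 // exprn_ge0 // ltW.
have Ajp : 0 < A (k.+1 + j)%N by rewrite lt_neqAle eq_sym Aj A_ge0.
rewrite -(ler_pM2l Ajp).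
have -> : (k.+2 + j.+1 = (k.+1 + j).+2)%N by rewrite !addSn addnS.
have r0 := ltW central_radius_gt0.
rewrite mulrA (le_trans (ler_wpM2r r0 (A_concave _)))//.
have -> : (k.+1 + j.+1 = (k.+1 + j).+1)%N by rewrite addnS.
rewrite expr2 -mulrA; have c0 : 0 <= t ^+ 2 * A (k.+1 + j).+1.
  by rewrite mulr_ge0 // exprn_ge0 // ltW.
apply: (@le_trans _ _ (t ^+ 2 * A (k.+1 + j).+1 *
    (A (k.+2 + j)%N * rho))).
  by rewrite expr2 !mulrA.
apply: (le_trans (ler_wpM2l c0 IHj)).
have -> : (j.+1.*2.+1 = 2 + j.*2.+1)%N by rewrite doubleS.
rewrite exprD le_eqVlt; apply/orP; left; apply/eqP.
by move: (t ^+ j.*2.+1) => z; ring.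
Qed.

Lemma up_le j : A (k.+1 + j) * rho ^+ j <= t ^+ (j ^ 2) * A k.+1.
Proof.
elim: j => [|j IHj]; first by rewrite addn0 expr0 mul1r mulr1.
have r0 := ltW central_radius_gt0.
have -> : (j.+1 ^ 2 = j.*2.+1 + j ^ 2)%N by lia.
rewrite exprD [rho ^+ _]exprS [A _ * _]mulrA addnS -addSn -[X in _ <= X]mulrA.
apply: (@le_trans _ _ (t ^+ j.*2.+1 * A (k.+1 + j)%N * rho ^+ j)).
  by rewrite ler_wpM2r ?exprn_ge0.
by rewrite -mulrA ler_wpM2l // exprn_ge0 // ltW.
Qed.

(** Mirror image of [step_up]; up to index [k.+2] every [A m] is positive and can be cancelled. *)
Let step_down j : (j <= k)%N ->
  A (k - j) <= t ^+ j.*2.+1 * rho * A (k - j).+1.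
Proof.
elim: j => [_|j IHj jk].
  rewrite subn0 expr1.
  rewrite -ler_sqr ?nnegrE ?mulr_ge0 ?(ltW central_radius_gt0) ?(ltW t0)//.
  rewrite [_ ^+ 2]expr2 {2}AkE mulrCA mulrC.
  apply: (le_trans (ler_wpM2r (exprn_ge0 2 (ltW central_radius_gt0)) (A_concave k))).
  by rewrite !exprMn mulrAC.
have e : (k - j = (k - j.+1).+1)%N by rewrite -subSn.
have := IHj (ltnW jk); rewrite e; move: (k - j.+1)%N e => m e IH.
have Am2 : 0 < A m.+2 by apply: A_gt0; lia.
rewrite -(ler_pM2r Am2) (le_trans (A_concave m))//.
have c0 : 0 <= t ^+ 2 * A m.+1 by rewrite mulr_ge0 // exprn_ge0 // ltW.
rewrite [A m.+1 ^+ 2]expr2 mulrA (le_trans (ler_wpM2l c0 IH))//.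
have -> : (j.+1.*2.+1 = 2 + j.*2.+1)%N by rewrite doubleS.
rewrite exprD le_eqVlt; apply/orP; left; apply/eqP.
by move: (t ^+ j.*2.+1) rho => z r; ring.
Qed.

Lemma down_le j : (j <= k.+1)%N ->
  A (k.+1 - j) <= t ^+ (j ^ 2) * rho ^+ j * A k.+1.
Proof.
elim: j => [_|j IHj jk]; first by rewrite subn0 !expr0 !mul1r.
rewrite subSS (le_trans (step_down jk))// -subSn //.
have -> : (j.+1 ^ 2 = j.*2.+1 + j ^ 2)%N by lia.
have r0 := ltW central_radius_gt0.
have c0 : 0 <= t ^+ j.*2.+1 * rho by rewrite mulr_ge0 ?exprn_ge0 // ltW.
apply: (le_trans (ler_wpM2l c0 (IHj (ltnW jk)))).
rewrite exprD [rho ^+ j.+1]exprS le_eqVlt; apply/orP; left; apply/eqP.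
by move: (t ^+ j.*2.+1) (t ^+ (j ^ 2)) (rho ^+ j) rho => x y z r; ring.
Qed.

End LogConcave.

(** * Dominance at the central radii *)

(** [theta_sum] in the variable [t = x^(-1/2)], in which it is a polynomial. *)
Definition gsum (R : realType) (t : R) (n : nat) : R :=
  \sum_(j < n) t ^+ (j.+1 ^ 2).

(** The last clause is the lower bound [t^(-2)] on the second quotients, multiplied out so that it
    makes sense beyond the degree of a polynomial; the second clause excludes gaps. *)
Definition gaussian_decay (R : realType) (a : nat -> Cplx R) (t : R) :=
  [/\ 0 < t, forall m, a m = 0 -> a m.+1 = 0 &
      forall m, nm (a m) * nm (a m.+2) <= t ^+ 2 * nm (a m.+1) ^+ 2].

Definition coef_radius (R : realType) (a : nat -> Cplx R) k :=
  central_radius (fun m => nm (a m)) k.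

Lemma big_ord_skip (V : nmodType) (F : nat -> V) K J :
  \sum_(i < K.+1 + J | i != K :> nat) F i =
  \sum_(i < K) F i + \sum_(j < J) F (K.+1 + j)%N.
Proof.
elim: J => [|J IHJ].
  rewrite addn0 big_mkcond big_ord_recr /= eqxx addr0 big_ord0 addr0.
  by apply: eq_bigr => i _; rewrite neq_ltn ltn_ord.
rewrite addnS big_mkcond big_ord_recr -big_mkcond /= IHJ.
by rewrite gtn_eqF ?addSn ?ltnS ?leq_addr// big_ord_recr /= addrA.
Qed.

Lemma ler_sum_ord_cond (R : realType) (F : nat -> R) (P : pred nat) N N' :
  (forall i, 0 <= F i) -> (N <= N')%N ->
  \sum_(i < N | P i) F i <= \sum_(i < N' | P i) F i.
Proof.
move=> F0 /subnKC <-; elim: (N' - N)%N => [|n IHn]; first by rewrite addn0.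
apply: (le_trans IHn).
rewrite addnS [leRHS]big_mkcond big_ord_recr -big_mkcond /= lerDl.
by case: ifP.
Qed.

Lemma gsum_homo (R : realType) (t : R) n m :
  0 <= t -> (n <= m)%N -> gsum t n <= gsum t m.
Proof.
by move=> t0; apply: (ler_sum_ord_cond (F := fun j => t ^+ (j.+1 ^ 2)) predT)
  => i; exact: exprn_ge0.
Qed.

Lemma coef_radius_gt0 (R : realType) (a : nat -> Cplx R) (t : R) k :
  gaussian_decay a t -> a k.+2 != 0 -> 0 < coef_radius a k.
Proof.
move=> [t0 supp conc] ak.
apply: (central_radius_gt0 (t := t)) => //; last by rewrite nm_eq0.
  by move=> m; exact: nm_ge0.
by move=> m /eqP; rewrite nm_eq0 => /eqP /supp ->; rewrite nm0.
Qed.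

Lemma sum_wt_le (R : realType) (a : nat -> Cplx R) (t : R) k J :
  gaussian_decay a t -> a k.+2 != 0 ->
  \sum_(i < k.+2 + J | i != k.+1 :> nat) wt (coef_radius a k) a i <=
    (gsum t k.+1 + gsum t J) * wt (coef_radius a k) a k.+1.
Proof.
move=> dec ak2; have r0 := coef_radius_gt0 dec ak2; case: dec => t0 supp conc.
have A0 m : 0 <= nm (a m) by exact: nm_ge0.
have supp' m : nm (a m) = 0 -> nm (a m.+1) = 0.
  by move=> /eqP; rewrite nm_eq0 => /eqP /supp ->; rewrite nm0.
have ak2' : nm (a k.+2) != 0 by rewrite nm_eq0.
have up := up_le (A := fun m => nm (a m)) A0 t0 supp' conc ak2'.
have dn := down_le (A := fun m => nm (a m)) A0 t0 supp' conc ak2'.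
rewrite -/(coef_radius a k) in up dn; move: (coef_radius a k) r0 up dn => r r0 up dn.
rewrite big_ord_skip mulrDl /gsum; apply: lerD.
  rewrite (reindex_inj rev_ord_inj) /= mulr_suml; apply: ler_sum => -[i /= ik] _.
  have rr : 0 <= r ^+ (k.+1 - i.+1) by rewrite exprn_ge0 // ltW.
  rewrite /wt; apply: (le_trans (ler_wpM2r rr (dn i.+1 ik))).
  by rewrite -(subnKC ik) [in leRHS]exprD subnKC // le_eqVlt; apply/orP; left;
    apply/eqP; move: (t ^+ _) (r ^+ _) (r ^+ _) => x y z; ring.
rewrite mulr_suml; apply: ler_sum => -[j /= jJ] _; rewrite /wt.
have -> : (k.+2 + j = k.+1 + j.+1)%N by rewrite addnS addSn.
have rr : 0 <= r ^+ k.+1 by rewrite exprn_ge0 // ltW.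
rewrite [in leLHS]exprD mulrA mulrAC mulrA.
exact: (ler_wpM2r rr (up j.+1)).
Qed.

(** Testing only those [J] with a nonzero coefficient lets a polynomial count just the terms it has
    above the centre. *)
Lemma central_dominant (R : realType) (a : nat -> Cplx R) (t th : R) k :
  gaussian_decay a t -> a k.+2 != 0 -> th < 1 ->
  (forall J, a (k.+1 + J)%N != 0 -> gsum t k.+1 + gsum t J <= th) ->
  dominant a k.+1 (coef_radius a k).
Proof.
move=> dec ak2 th1 sth; have r0 := coef_radius_gt0 dec ak2.
have [t0 supp _] := dec.
have ak1 : a k.+1 != 0 by apply: contra_neq ak2; exact: supp.
have s0 n : 0 <= gsum t n by apply: sumr_ge0 => i _; rewrite exprn_ge0 // ltW.
have w0 i : 0 <= wt (coef_radius a k) a i by exact/wt_ge0/ltW.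
exists th; split=> [|N].
  rewrite th1 andbT; apply: le_trans (sth 0 _); first exact: addr_ge0.
  by rewrite addn0.
apply: (@le_trans _ _ (\sum_(i < k.+2 + N | i != k.+1 :> nat)
    wt (coef_radius a k) a i)).
  by apply: (ler_sum_ord_cond (fun i => i != k.+1)) => //; exact: leq_addl.
elim: N => [|N IHN].
  apply: (le_trans (sum_wt_le 0 dec ak2)); rewrite ler_wpM2r // sth //.
  by rewrite addn0.
have [aN|aN] := eqVneq (a (k.+1 + N.+1)%N) 0; last first.
  by apply: (le_trans (sum_wt_le N.+1 dec ak2)); rewrite ler_wpM2r // sth.
rewrite addnS big_mkcond big_ord_recr -big_mkcond /= /wt [in X in _ + X](_ : a _ = 0).
  by rewrite nm0 mul0r if_same addr0.
by rewrite addSn -addnS.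
Qed.

(** * Extreme radii and the chain of radii *)

(** Shrinking the radius to at most [rho * q] multiplies every term of positive index by at most
    [q]; [q] is chosen against the l1 bound at [rho]. *)
Lemma dominant_small (R : realType) (a : nat -> Cplx R) k (rho r : R) :
  a 0 != 0 -> 0 < rho -> dominant a k rho -> 0 < r ->
  exists2 rho0, 0 < rho0 <= r & dominant a 0 rho0.
Proof.
move=> a0 r0 dom rr; have [S aS] := dominant_l1 (ltW r0) dom.
have S0 : 0 <= S by have := aS 0; rewrite big_ord0.
have S1 : 0 < S + 1 by rewrite ltr_wpDl.
have A0 : 0 < nm (a 0) by rewrite nm_gt0.
pose q := Num.min 1 (nm (a 0) / (2 * (S + 1))).
have q0 : 0 < q by rewrite lt_min ltr01 divr_gt0 ?mulr_gt0.
have q1 : q <= 1 by rewrite ge_min lexx.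
have qS : q * S <= nm (a 0) / 2.
  apply: (@le_trans _ _ (nm (a 0) / (2 * (S + 1)) * S)).
    by rewrite ler_wpM2r // ge_min lexx orbT.
  rewrite invfM mulrA -mulrA ler_piMr ?divr_ge0 ?nm_ge0//.
  by rewrite mulrC ler_pdivrMr // mul1r lerDl.
pose s := Num.min r (rho * q).
have s0 : 0 < s by rewrite lt_min rr mulr_gt0.
exists s; first by rewrite s0 ge_min lexx.
exists (2^-1); split; first by rewrite invr_ge0 ler0n invf_lt1 ?ltr1n.
case=> [|N]; first by rewrite big_ord0 mulr_ge0 ?wt_ge0 ?ltW ?invr_gt0.
rewrite big_mkcond big_ord_recl /= add0r.
rewrite {2}/wt expr0 mulr1 mulrC (le_trans _ qS)//.
apply: (@le_trans _ _ (q * \sum_(i < N.+1) wt rho a i)); last first.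
  by rewrite ler_wpM2l // ltW.
rewrite big_ord_recl /= mulrDr -[leLHS]add0r lerD //.
  by rewrite mulr_ge0 ?wt_ge0 ?ltW.
rewrite mulr_sumr; apply: ler_sum => i _; rewrite /wt mulrCA ler_wpM2l ?nm_ge0//.
apply: (@le_trans _ _ ((rho * q) ^+ i.+1)).
  by rewrite lerXn2r ?nnegrE ?(ltW s0) ?mulr_ge0 ?(ltW r0) ?(ltW q0)// ge_min lexx orbT.
rewrite exprMn mulrC ler_wpM2r ?exprn_ge0 ?(ltW r0)//.
by rewrite exprS ler_piMr ?(ltW q0)// exprn_ile1 // ltW.
Qed.

Lemma dominant_large (R : realType) (a : nat -> Cplx R) d (r : R) :
  a d.+1 != 0 -> (forall i, (d.+1 < i)%N -> a i = 0) ->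
  exists2 rho, r < rho & dominant a d.+1 rho.
Proof.
move=> ad ai; pose S := \sum_(i < d.+1) nm (a i).
have S0 : 0 <= S by apply: sumr_ge0 => i _; exact: nm_ge0.
have A0 : 0 < nm (a d.+1) by rewrite nm_gt0.
have c0 : 0 <= 2 * S / nm (a d.+1) by rewrite divr_ge0 ?mulr_ge0 ?nm_ge0.
(* The three summands give [s > r], [s ^+ i <= s ^+ d] for [i <= d], and
   [2 * S <= nm (a d.+1) * s]. *)
pose s := `|r| + 1 + 2 * S / nm (a d.+1).
have s1 : 1 <= s by rewrite /s -addrA addrCA lerDl addr_ge0.
have s0 : 0 <= s by exact: le_trans s1.
exists s; first by rewrite /s -addrA (le_lt_trans (ler_norm r))// ltrDl ltr_wpDr.
exists (2^-1); split; first by rewrite invr_ge0 ler0n invf_lt1 ?ltr1n.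
move=> N; apply: (@le_trans _ _ (\sum_(i < d.+2 + N | i != d.+1 :> nat) wt s a i)).
  apply: (ler_sum_ord_cond (fun i => i != d.+1)); last exact: leq_addl.
  by move=> i; exact: wt_ge0.
rewrite big_ord_skip [X in _ + X]big1 ?addr0 => [|i _]; last first.
  by rewrite /wt ai ?nm0 ?mul0r// addSn ltnS leq_addr.
apply: (@le_trans _ _ (S * s ^+ d)).
  rewrite mulr_suml; apply: ler_sum => -[i /= id] _.
  by rewrite /wt ler_wpM2l ?nm_ge0// ler_weXn2l.
have key : 2 * S <= nm (a d.+1) * s.
  by rewrite [nm _ * s]mulrC -ler_pdivrMr // /s lerDr addr_ge0.
rewrite /wt exprS !mulrA ler_wpM2r ?exprn_ge0// -mulrA.
by move: key; move: (nm _ * s) => x; lra.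
Qed.

(** Discrete intermediate value argument: somewhere the radii cross [r] upwards. *)
Lemma locate (R : realType) (rad : nat -> R) (r : R) M :
  rad 0 <= r -> r < rad M -> exists2 k, (k < M)%N & rad k <= r < rad k.+1.
Proof.
move=> r0; elim: M => [|M IHM] rM; first by have := le_lt_trans r0 rM; rewrite ltxx.
have [rM'|/IHM[k kM kr]] := leP (rad M) r; last by exists k => //; exact: leqW.
by exists M => //; rewrite rM'.
Qed.

Lemma separating_radii (R : realType) (a : nat -> Cplx R) (rad : nat -> R)
    (r : R) M :
  (forall k, (k <= M)%N -> [/\ 0 < rad k, a k != 0 & dominant a k (rad k)]) ->
  rad 0 <= r -> r < rad M ->
  exists k rho rho', [/\ 0 < rho <= r, r < rho', a k != 0 /\ a k.+1 != 0,
    dominant a k rho & dominant a k.+1 rho'].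
Proof.
move=> H r0 rM; have [k kM /andP[kr rk]] := locate r0 rM.
have [k0 ak dk] := H k (ltnW kM); have [k1 ak1 dk1] := H k.+1 kM.
by exists k, (rad k), (rad k.+1); rewrite k0 kr.
Qed.

(** In degree [d.+2] the index [k.+1] has [k.+1] terms below it and [d.+1 - k] above it. *)
Lemma decay_separating_poly (R : realType) (a : nat -> Cplx R) (t : R) d :
  gaussian_decay a t -> (forall i, (i <= d.+2)%N -> a i != 0) ->
  (forall i, (d.+2 < i)%N -> a i = 0) ->
  (forall k, (k <= d)%N -> gsum t k.+1 + gsum t (d.+1 - k) < 1) ->
  separating a.
Proof.
move=> dec a0 a1 g1 r rr; have [t0 _ _] := dec.
have cen k : (k <= d)%N -> dominant a k.+1 (coef_radius a k).
  move=> kd; apply: (central_dominant dec _ (g1 k kd)); first exact: a0.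
  move=> J aJ; rewrite lerD2l gsum_homo ?(ltW t0)//.
  rewrite leqNgt; apply: contra_neqN aJ => Jd; apply: a1; lia.
have cr0 k : (k <= d)%N -> 0 < coef_radius a k.
  by move=> kd; apply: (coef_radius_gt0 dec); exact: a0.
have [r1 /andP[r10 r1r] dr1] := dominant_small (a0 0 isT) (cr0 0 isT) (cen 0 isT) rr.
have [r2 r2r dr2] := dominant_large r (a0 d.+2 (leqnn _)) a1.
(* Index 0 dominates at [r1], the indices from 1 to [d.+1] at their central radii, the top index at
   [r2]. *)
pose rad k := if k is k'.+1 then if (k' <= d)%N then coef_radius a k' else r2
  else r1.
apply: (separating_radii (rad := rad) (M := d.+2)) => [k kd||] //=; last first.
  by rewrite ltnn.
case: k kd => [_|k kd] /=; first by split=> //; exact: a0.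
have [kd'|dk] := leqP k d; first by split; [exact: cr0|exact: a0|exact: cen].
have -> : k = d.+1 by apply/eqP; rewrite eqn_leq dk andbT.
by split=> //; [exact: lt_trans r2r|exact: a0].
Qed.

(** The ratios [q m] grow at least by the factor [t^(-2)] per step, and [coef_radius a m] is the
    geometric mean of [q m] and [q m.+1]. *)
Lemma coef_radius_unbounded (R : realType) (a : nat -> Cplx R) (t r : R) :
  gaussian_decay a t -> t < 1 -> (forall i, a i != 0) ->
  exists k, r < coef_radius a k.
Proof.
move=> [t0 _ conc] t1 a0; apply: contrapT => nk.
have A0 i : 0 < nm (a i) by rewrite nm_gt0.
pose q m := nm (a m) / nm (a m.+1).
have q0 m : 0 < q m by rewrite divr_gt0.
have qS m : q m <= t ^+ 2 * q m.+1.
  rewrite /q mulrA ler_pdivrMr // mulrAC ler_pdivlMr // -mulrA -expr2.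
  exact: conc.
have t21 : 0 <= t ^+ 2 < 1 by rewrite exprn_ge0 ?exprn_ilt1 ?ltW.
have qg m : q 0 <= (t ^+ 2) ^+ m * q m.
  elim: m => [|m IHm]; first by rewrite mul1r.
  rewrite (le_trans IHm)// [(t ^+ 2) ^+ m.+1]exprSr -mulrA ler_wpM2l //.
  by rewrite !exprn_ge0 // ltW.
have qr m : q m <= r.
  apply: le_trans (_ : coef_radius a m <= r); last first.
    by rewrite leNgt; apply/negP => h; apply: nk; exists m.
  rewrite -[q m]gtr0_norm// -sqrtr_sqr ler_wsqrtr // expr2.
  have : q m * q m <= q m * q m.+1.
    rewrite ler_wpM2l ?(ltW (q0 _))// (le_trans (qS m))// ler_piMl ?(ltW (q0 _))//.
    by have /andP[_ /ltW] := t21.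
  by move/le_trans; apply; rewrite /q mulrA divfK // lt0r_neq0.
have : q 0 = 0.
  apply: (ler_geometric_eq0 (ltW (q0 0)) t21) => m.
  rewrite (le_trans (qg m))// ler_wpM2l ?qr// exprn_ge0 //.
  by case/andP: t21.
by move=> q00; have := q0 0; rewrite q00 ltxx.
Qed.

Lemma decay_separating_entire (R : realType) (a : nat -> Cplx R) (t : R) :
  gaussian_decay a t -> t < 1 -> (forall i, a i != 0) ->
  (forall n, gsum t n <= 2^-1) -> separating a.
Proof.
move=> dec t1 a0 g1 r rr; have [t0 _ _] := dec.
have cen k : dominant a k.+1 (coef_radius a k).
  (* Only [k.+1] terms lie below the centre, so [gsum t k.+1] misses [1/2] by at least the next term
     [t ^+ (k.+2 ^ 2)]; this slack permits the nonstrict hypothesis. *)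
  apply: (@central_dominant _ _ t (1 - t ^+ (k.+2 ^ 2))) => //.
    by rewrite gtrBl exprn_gt0.
  move=> J _; have := g1 k.+2; have := g1 J; rewrite /gsum big_ord_recr /=.
  by lra.
have cr0 k : 0 < coef_radius a k by exact: (coef_radius_gt0 dec).
have [r1 /andP[r10 r1r] dr1] := dominant_small (a0 0) (cr0 0) (cen 0) rr.
have [M rM] := coef_radius_unbounded r dec t1 a0.
pose rad k := if k is k'.+1 then coef_radius a k' else r1.
by apply: (separating_radii (rad := rad) (M := M.+1)) => //; case=> [|k] _ /=.
Qed.

(** * Theta sums and the constants [b_even] and [b_infty] *)

(** The terms of [gsum] decrease, so moving [m] terms from the longer sum to the shorter one raises
    the total: the balanced split is the worst case. *)
Lemma gsum_concave (R : realType) (t : R) p q m :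
  0 <= t <= 1 -> (p <= q)%N ->
  gsum t p + gsum t (q + m) <= gsum t (p + m) + gsum t q.
Proof.
move=> /andP[t0 t1] pq; elim: m => [|m IHm]; first by rewrite !addn0 addrC.
rewrite !addnS /gsum !big_ord_recr /= -/(gsum t p) -/(gsum t q).
rewrite -/(gsum t (q + m)) -/(gsum t (p + m)) addrA [leRHS]addrAC lerD //.
by rewrite ler_wiXn2l // leq_exp2r // ltnS leq_add2r.
Qed.

Lemma gsum_lt (R : realType) (t s : R) n :
  0 <= t -> t < s -> (0 < n)%N -> gsum t n < gsum s n.
Proof.
case: n => // n t0 ts _; rewrite /gsum !big_ord_recl ltr_leD //=.
apply: ler_sum => i _; rewrite lerXn2r ?nnegrE ?(ltW ts)//.
by rewrite ltW // (le_lt_trans t0).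
Qed.

Lemma theta_sumE (R : realType) n (x : R) :
  0 < x -> theta_sum n x = gsum (Num.sqrt x)^-1 n.
Proof.
move=> x0; rewrite /theta_sum big_add1 big_mkord; apply: eq_bigr => i _.
rewrite powRN mulrC powRrM powR12_sqrt ?(ltW x0)// -natrX powR_mulrn ?sqrtr_ge0//.
by rewrite exprVn.
Qed.

(** The constant is the maximum of the derivative of [t ^+ m.+1] on [[0, 1/2]]. *)
Lemma half_lipschitz (R : realType) (t s : R) m :
  0 <= t <= 2^-1 -> 0 <= s <= 2^-1 ->
  `|t ^+ m.+1 - s ^+ m.+1| <= m.+1%:R * 2^-1 ^+ m * `|t - s|.
Proof.
move=> /andP[t0 t1] /andP[s0 s1]; elim: m => [|m IHm]; first by rewrite expr0 !mul1r.
rewrite (_ : t ^+ m.+2 - s ^+ m.+2 =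
  t * (t ^+ m.+1 - s ^+ m.+1) + s ^+ m.+1 * (t - s)); last first.
  by rewrite !(exprS _ m.+1); move: (_ ^+ _) (_ ^+ _) => x y; ring.
rewrite (le_trans (ler_normD _ _))// !normrM (ger0_norm t0).
rewrite [`|s ^+ _|]ger0_norm ?exprn_ge0//.
rewrite -[m.+2%:R]natr1 mulrDl mulrDl mul1r lerD //.
  by rewrite [2^-1 ^+ m.+1]exprS [m.+1%:R * _]mulrCA -mulrA; exact: ler_pM.
by rewrite ler_wpM2r // lerXn2r // nnegrE.
Qed.

(** The constant is uniform in [n], so the estimate passes to the infinite series; 4 bounds the sum
    of the majorants [2 * 2^-1 ^+ i]. *)
Lemma gsum_lipschitz (R : realType) (t s : R) n :
  0 <= t <= 2^-1 -> 0 <= s <= 2^-1 ->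
  `|gsum t n - gsum s n| <= 4 * `|t - s|.
Proof.
move=> t01 s01; rewrite /gsum -sumrB (le_trans (ler_norm_sum _ _ _))//.
have h01 : 0 <= (2^-1 : R) < 1 by rewrite invr_ge0 ler0n invf_lt1 ?ltr1n.
apply: (@le_trans _ _ (\sum_(i < n) 2 * 2^-1 ^+ i * `|t - s|)); last first.
  rewrite -mulr_suml -mulr_sumr ler_wpM2r //.
  have := geometric_sum_le 0 n h01; rewrite big_mkord expr0.
  have -> : 1 / (1 - 2^-1) = 2 :> R by field.
  by move: (\sum_(i < n) _) => x; lra.
apply: ler_sum => -[i /= _] _.
have -> : (i.+1 ^ 2 = (i ^ 2 + i.*2).+1)%N by lia.
rewrite (le_trans (half_lipschitz _ t01 s01))// ler_wpM2r //.
have i2 : (i < 2 ^ i)%N by exact: ltn_expl.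
have h2 : (i ^ 2 + i.*2).+1%:R <= (2 : R) ^+ (i.*2).
  rewrite -natrX ler_nat -muln2 expnM; nia.
apply: (@le_trans _ _ ((2 : R) ^+ i.*2 * 2^-1 ^+ (i.*2 + i))).
  apply: ler_pM => //.
  have : (i <= i ^ 2)%N by nia.
  move=> ii; rewrite ler_wiXn2l ?invr_ge0 ?invf_le1 ?ler1n//; lia.
rewrite exprD mulrA -exprMn divff ?pnatr_eq0// expr1n mul1r.
by rewrite ler_peMl ?exprn_ge0 ?invr_ge0 ?ler1n.
Qed.

(** Serves the finite and the infinite sum alike: both vanish at 0 and at [1/2] are at least their
    first term. *)
Lemma lipschitz_half_root (R : realType) (phi : R -> R) :
  (forall t s, 0 <= t <= 2^-1 -> 0 <= s <= 2^-1 ->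
    `|phi t - phi s| <= 4 * `|t - s|) ->
  phi 0 = 0 -> 2^-1 <= phi 2^-1 ->
  exists2 t, 0 < t <= 2^-1 & phi t = 2^-1.
Proof.
move=> lip phi0 phi1; have h0 : 0 < 2^-1 :> R by rewrite invr_gt0.
have cont : {within `[0, 2^-1], continuous phi}.
  apply/subspace_continuousP => x; rewrite /= in_itv /= => x01.
  apply/cvgrPdist_le => e e0; rewrite near_withinE.
  have e4 : 0 < e / 4 by rewrite divr_gt0.
  have := nbhsx_ballx x _ e4; apply: filterS => y /= xy.
  rewrite in_itv /= => y01; rewrite (le_trans (lip _ _ x01 y01))//.
  by rewrite mulrC -ler_pdivlMr // ltW.
have [|t tI pt] := IVT (v := 2^-1) (ltW h0) cont.
  by rewrite phi0 ge_min le_max phi1 (ltW h0) orbT.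
exists t => //; move: tI; rewrite in_itv /= => /andP[t0 ->]; rewrite andbT.
rewrite lt_neqAle t0 andbT; apply/eqP => t0'; move: pt; rewrite -t0' phi0 => /eqP.
by rewrite lt_eqF.
Qed.

Lemma gsum0 (R : realType) n : gsum (0 : R) n = 0.
Proof. by rewrite /gsum big1 // => i _; rewrite expr0n. Qed.

Lemma gsum_ge (R : realType) (t : R) n : 0 <= t -> (0 < n)%N -> t <= gsum t n.
Proof.
move=> t0 n0; have := gsum_homo t0 n0.
by rewrite {1}/gsum big_ord_recl big_ord0 addr0.
Qed.

(** Existence of a root makes [xget] return one; [(t ^+ 2)^-1] undoes the substitution of
    [theta_sumE]. *)
Lemma b_evenP (R : realType) n : (0 < n)%N ->
  0 < b_even R n /\ 2 * gsum (Num.sqrt (b_even R n))^-1 n = 1.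
Proof.
move=> n0; have : exists x : R, 0 < x /\ 1 - 2 * theta_sum n x = 0.
  have [|||t /andP[t0 _] gt] := @lipschitz_half_root R (fun t => gsum t n).
  - by move=> t s; exact: gsum_lipschitz.
  - exact: gsum0.
  - by rewrite gsum_ge // invr_ge0.
  have t2 : 0 < (t ^+ 2)^-1 by rewrite invr_gt0 exprn_gt0.
  exists ((t ^+ 2)^-1); split=> //; rewrite theta_sumE // sqrtrV ?exprn_ge0 ?(ltW t0)//.
  by rewrite sqrtr_sqr ger0_norm ?(ltW t0)// invrK gt divff ?pnatr_eq0 // subrr.
move=> /(xgetPex 0); rewrite -/(b_even R n) => -[b0 be]; split=> //.
by rewrite -theta_sumE //; apply/eqP; rewrite eq_sym -subr_eq0; apply/eqP.
Qed.

Lemma gsum_cvg (R : realType) (t : R) : 0 <= t < 1 -> cvgn (gsum t).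
Proof.
move=> t01; have /andP[t0 t1] := t01; apply: nondecreasing_is_cvgn.
  by move=> n m nm; exact: gsum_homo.
exists (1 / (1 - t)) => _ [n _ <-]; have := geometric_sum_le 0 n t01.
rewrite expr0 big_mkord; apply: le_trans; apply: ler_sum => -[i /= _] _.
by rewrite ler_wiXn2l ?(ltW t1)//; nia.
Qed.

Lemma b_inftyP (R : realType) : 1 < b_infty R /\
  forall n, gsum (Num.sqrt (b_infty R))^-1 n <= 2^-1.
Proof.
have h1 : 2^-1 < 1 :> R by rewrite invf_lt1 ?ltr1n.
have : exists x : R, 1 < x /\ 1 - 2 * limn (fun n => theta_sum n x) = 0.
  have [|||t /andP[t0 th] gt] := @lipschitz_half_root R (fun t => limn (gsum t)).
  - move=> t s t01 s01.
    have ct : cvgn (gsum t).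
      by apply: gsum_cvg; case/andP: t01 => -> /le_lt_trans; apply.
    have cs : cvgn (gsum s).
      by apply: gsum_cvg; case/andP: s01 => -> /le_lt_trans; apply.
    have h : `|gsum t n - gsum s n| @[n --> \oo] -->
        `|limn (gsum t) - limn (gsum s)|.
      by apply: cvg_norm; apply: cvgB.
    apply: (ler_cvg_to h (cvg_cst _)); apply: nearW => n.
    exact: gsum_lipschitz.
  - have -> : gsum 0 = (fun=> 0) :> (nat -> R) by apply/funext => n; exact: gsum0.
    exact: lim_cst.
  - have h01 : 0 <= (2^-1 : R) < 1 by rewrite invr_ge0 ler0n.
    apply: (@le_trans _ _ (gsum 2^-1 1)); first by rewrite gsum_ge ?invr_ge0.
    apply: nondecreasing_cvgn_le; last exact: gsum_cvg.
    by move=> n m nm; apply: gsum_homo => //; rewrite invr_ge0.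
  have t2 : 1 < (t ^+ 2)^-1.
    rewrite invf_gt1 ?exprn_gt0// exprn_ilt1 ?(ltW t0)//.
    exact: le_lt_trans h1.
  exists ((t ^+ 2)^-1); split=> //.
  have -> : (fun n => theta_sum n (t ^+ 2)^-1) = gsum t.
    apply/funext => n; rewrite theta_sumE ?(lt_trans ltr01)//.
    rewrite sqrtrV ?exprn_ge0 ?(ltW t0)//.
    by rewrite sqrtr_sqr ger0_norm ?(ltW t0)// invrK.
  by rewrite gt divff ?pnatr_eq0 // subrr.
move=> /(xgetPex 0); rewrite -/(b_infty R) => -[b1 be]; split=> // n.
have b0 : 0 < b_infty R by exact: lt_trans b1.
move: be; have -> : (fun n => theta_sum n (b_infty R)) =
    gsum (Num.sqrt (b_infty R))^-1.
  by apply/funext => m; rewrite theta_sumE.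
have s1 : 1 < Num.sqrt (b_infty R) by rewrite -sqrtr1 ltr_sqrt.
have s0 := lt_trans ltr01 s1.
have c : cvgn (gsum (Num.sqrt (b_infty R))^-1).
  by apply: gsum_cvg; rewrite invr_ge0 ltW //= invf_lt1.
have : gsum (Num.sqrt (b_infty R))^-1 n <= limn (gsum (Num.sqrt (b_infty R))^-1).
  by apply: nondecreasing_cvgn_le => // i j ij; apply: gsum_homo.
by move: (gsum _ n) (limn _) => x y; lra.
Qed.

(** * From second quotients to the three statements *)

Lemma second_quotient_decay (R : realType) (a : nat -> Cplx R) (B : R) :
  0 < B -> (forall m, a m = 0 -> a m.+1 = 0) ->
  (forall k, (2 <= k)%N -> a k != 0 -> B <= nm (second_quotient a k)) ->
  gaussian_decay a (Num.sqrt B)^-1.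
Proof.
move=> B0 supp aB; split=> // [|m]; first by rewrite invr_gt0 sqrtr_gt0.
rewrite exprVn sqr_sqrtr ?(ltW B0)//.
have [am2|am2] := eqVneq (a m.+2) 0.
  by rewrite am2 nm0 mulr0 mulr_ge0 ?exprn_ge0 ?nm_ge0 ?invr_ge0 ?(ltW B0).
have am1 : a m.+1 != 0 by apply: contra_neq am2; exact: supp.
have am : a m != 0 by apply: contra_neq am1; exact: supp.
have := aB m.+2 isT am2; rewrite /second_quotient /= nmM nmV nmX nmM.
by rewrite ler_pdivlMr ?mulr_gt0 ?nm_gt0// ler_pdivlMl.
Qed.

Lemma min_gap (R : realType) (u : nat -> R) (b : R) N :
  (forall k, (k < N)%N -> b < u k) ->
  exists2 B, b < B & forall k, (k < N)%N -> B <= u k.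
Proof.
elim: N => [|N IHN] h; first by exists (b + 1) => //; rewrite ltrDl.
have [k kN|B bB BN] := IHN; first by apply: h; exact: ltnW.
exists (Num.min B (u N)) => [|k]; first by rewrite lt_min bB h.
rewrite ltnS leq_eqVlt => /orP[/eqP->|kN]; first by rewrite ge_min lexx orbT.
by rewrite ge_min BN.
Qed.

Lemma poly_supp (R : realType) (P : {poly Cplx R}) d :
  size P = d.+1 -> (forall k, (k <= d)%N -> P`_k != 0) ->
  forall m, P`_m = 0 -> P`_m.+1 = 0.
Proof.
move=> sP P0 m Pm; apply: nth_default; rewrite sP ltnS leqNgt.
by apply: contra_eqN Pm => md; apply: P0; exact: ltnW.
Qed.

Lemma poly_separating (R : realType) (P : {poly Cplx R}) d (B : R) :
  (2 <= d)%N -> size P = d.+1 -> (forall k, (k <= d)%N -> P`_k != 0) ->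
  0 < B ->
  (forall k, (2 <= k <= d)%N -> B <= nm (second_quotient (fun j => P`_j) k)) ->
  (forall k, (0 < k < d)%N -> gsum (Num.sqrt B)^-1 k +
    gsum (Num.sqrt B)^-1 (d - k) < 1) ->
  poly_zeros_simple P /\ zeros_moduli_distinct (horner P).
Proof.
case: d => [|[|d]] // _ sP P0 B0 PB gB.
apply: separating_poly; first exact: P0.
apply: (@decay_separating_poly _ _ (Num.sqrt B)^-1 d) => //.
- apply: second_quotient_decay => //; first exact: (poly_supp sP P0).
  move=> k k2 Pk; apply: PB; rewrite k2 /= leqNgt; apply: contra_neqN Pk => dk.
  by apply: nth_default; rewrite sP.
- by move=> i di; apply: nth_default; rewrite sP.
by move=> k kd; have := gB k.+1; rewrite subSS; apply; lia.
Qed.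

Theorem theorem1p1 (R : realType) :
  [/\ (forall (n : nat) (P : {poly Cplx R}),
        (0 < n)%N ->
        size P = (2 * n).+1 ->
        (forall k : nat, (k <= 2 * n)%N -> P`_k != 0) ->
        (forall k : nat, (2 <= k <= 2 * n)%N ->
           (b_even R n)%:C < `|second_quotient (fun j => P`_j) k|) ->
        poly_zeros_simple P /\ zeros_moduli_distinct (horner P)),
      (forall (n : nat) (P : {poly Cplx R}),
        (0 < n)%N ->
        size P = (2 * n).+2 ->
        (forall k : nat, (k <= (2 * n).+1)%N -> P`_k != 0) ->
        (forall k : nat, (2 <= k <= (2 * n).+1)%N ->
           (b_even R n.+1)%:C <= `|second_quotient (fun j => P`_j) k|) ->
        poly_zeros_simple P /\ zeros_moduli_distinct (horner P)) &
      (forall (a : nat -> Cplx R) (f : Cplx R -> Cplx R),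
        entire f ->
        is_power_series a f ->
        (forall k : nat, a k != 0) ->
        (forall k : nat, (2 <= k)%N ->
           (b_infty R)%:C <= `|second_quotient a k|) ->
        zeros_simple f /\ zeros_moduli_distinct f)].
Proof.
split=> [n P n0 sP P0 Pb|n P n0 sP P0 Pb|a f ef af a0 ab].
- have [b0 gb] := b_evenP R n0.
  (* At [b_even] itself the middle index, with [n] terms on each side, would give exactly 1.
     Finitely many strict inequalities leave room for a larger [B], which makes the sum strictly
     smaller. *)
  have [k kn|B bB BP] := @min_gap R
      (fun k => nm (second_quotient (fun j => P`_j) k.+2)) (b_even R n) (2 * n).-1.
    by have := Pb k.+2; rewrite nmE ltcR; apply; lia.
  have B0 := lt_trans b0 bB.
  apply: (poly_separating (d := 2 * n) (B := B)) => //; first lia.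
    move=> [|[|k]] // kn; apply: BP; lia.
  set t := (Num.sqrt B)^-1; set tb := (Num.sqrt (b_even R n))^-1 in gb.
  have t0 : 0 <= t by rewrite invr_ge0.
  have ttb : t < tb by rewrite ltf_pV2 ?posrE ?sqrtr_gt0// ltr_sqrt.
  have tb2 := gsum_ge (le_trans t0 (ltW ttb)) n0.
  have t01 : 0 <= t <= 1 by rewrite t0 /=; lra.
  have glt := gsum_lt t0 ttb n0.
  (* The split of [2 * n] terms into [n] and [n] is the worst. *)
  have main k : (k <= n)%N -> gsum t k + gsum t (2 * n - k) < 1.
    move=> kn; have := gsum_concave (n - k) t01 kn.
    rewrite subnKC // (_ : n + (n - k) = 2 * n - k)%N; last lia.
    by move/le_lt_trans; apply; lra.
  (* The case [k > n] follows by exchanging the two sides. *)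
  move=> k /andP[k0 kd]; have [|nk] := leqP k n; first exact: main.
  rewrite addrC -[X in _ + gsum t X](@subKn k (2 * n)); last exact: ltnW.
  by apply: main; lia.
- have [b0 gb] := b_evenP R (ltn0Sn n).
  apply: (poly_separating (d := (2 * n).+1) (B := b_even R n.+1)) => //; first lia.
    by move=> k kn; have := Pb k kn; rewrite nmE lecR.
  set t := (Num.sqrt _)^-1 in gb *.
  have t0 : 0 < t by rewrite invr_gt0 sqrtr_gt0.
  have t1 := gsum_ge (ltW t0) (ltn0Sn n).
  have t01 : 0 <= t <= 1 by rewrite (ltW t0) /=; lra.
  (* In odd degree the worst split is [n] and [n.+1]; one term is missing from
     [2 * gsum t n.+1 = 1], hence strictness under a nonstrict hypothesis. *)
  have glt : gsum t n < gsum t n.+1.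
    by rewrite /gsum big_ord_recr ltrDl exprn_gt0.
  have main k : (k <= n)%N -> gsum t k + gsum t ((2 * n).+1 - k) < 1.
    move=> kn; have := gsum_concave (n - k) t01 (leqW kn).
    rewrite subnKC // (_ : n.+1 + (n - k) = (2 * n).+1 - k)%N; last lia.
    by move/le_lt_trans; apply; lra.
  move=> k /andP[k0 kd]; have [|nk] := leqP k n; first exact: main.
  rewrite addrC -[X in _ + gsum t X](@subKn k (2 * n).+1); last exact: ltnW.
  by apply: main; lia.
have [b1 gb] := b_inftyP R; have b0 := lt_trans ltr01 b1.
apply: (separating_entire ef af (a0 0)).
apply: (@decay_separating_entire _ _ (Num.sqrt (b_infty R))^-1) => //.
  apply: second_quotient_decay => //.
    by move=> m am; have := a0 m; rewrite am eqxx.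
  by move=> k k2 _; have := ab k k2; rewrite nmE lecR.
by rewrite invf_lt1 ?sqrtr_gt0// -sqrtr1 ltr_sqrt.
Qed.
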